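(* Let $(M,\mathbf m)$ be a metric projective geometry of dimension $n\ge 2$. Suppose that it has projective Weyl nullity at a point $x\in M$, and let $v\neq 0$ be a vector in the Weyl nullity subspace of $T_xM$. Then, for any metric $g\in\mathbf m$, the curvature $R^i{}_{jk\ell}$ of $g$ satisfies $$R^i{}_{jk\ell}\,v^j=-B\,v^jK^i{}_{jk\ell}\quad\text{at }x,\qquad (\ast)$$ where $B\in\mathbb R$ is the number determined by $\mathsf P^i{}_jv^j=Bv^i$ at $x$ and $K^i{}_{jk\ell}:=\delta^i_\ell g_{jk}-\delta^i_kg_{j\ell}$. Conversely, if $(\ast)$ holds at $x$ for some metric $g\in\mathbf m$ and some number $B$, with $v\in T_xM\setminus\{0\}$, then $v$ is in the Weyl nullity at $x$.
   Context: Manifolds are smooth and connected; metrics are smooth, pseudo-Riemannian, of arbitrary signature; indices are abstract indices. Two metrics are projectively equivalent if they have the same geodesics up to reparametrisation; a metric projective structure $\mathbf m$ on $M$ is an equivalence class of projectively equivalent metrics, and $(M,\mathbf m)$ is called a metric projective geometry. For the Levi-Civita connection $\nabla$ of a metric $g$, the curvature is defined by $[\nabla_\ell,\nabla_k]v^j=R^j{}_{i\ell k}v^i$, the Ricci tensor by $R_{jk}=R^a{}_{jak}$, the projective Schouten tensor by $\mathsf P_{jk}=\frac1{n-1}R_{jk}$, with $\mathsf P^i{}_j=g^{ik}\mathsf P_{kj}$. The projective Weyl tensor is $W^i{}_{jk\ell}=R^i{}_{jk\ell}+\delta^i_\ell\mathsf P_{jk}-\delta^i_k\mathsf P_{j\ell}$;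 it is the same for all metrics in $\mathbf m$. $(M,\mathbf m)$ has (projective) Weyl nullity at $x$ if there is a nonzero $v\in T_xM$ with $W^i{}_{jk\ell}v^j=0$ at $x$; such $v$ is said to be in the Weyl nullity at $x$, and the nullity subspace is the space of all $v\in T_xM$ with $W^i{}_{jk\ell}v^j=0$. For $v$ in the nullity and any $g\in\mathbf m$, $v$ is an eigenvector of $\mathsf P^i{}_j$ at $x$, so $B$ is well defined. *)

(* Defs.v *)
From mathcomp Require Import all_boot all_order all_algebra.
From mathcomp Require Import all_classical all_reals all_analysis.
Import Order.TTheory GRing.Theory Num.Theory.
Import numFieldNormedType.Exports.

Set Implicit Arguments.
Unset Strict Implicit.
Unset Printing Implicit Defensive.

Local Open Scope classical_set_scope.
Local Open Scope ring_scope.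

Section Smooth.
Variables (R : realType) (n : nat).

Fixpoint Ck (k : nat) (U : set 'rV[R]_n) (f : 'rV[R]_n -> R) : Prop :=
  (forall u, U u -> {for u, continuous f}) /\
  (if k is k'.+1 then
     forall i : 'I_n, (forall u, U u -> derivable f u 'e_i) /\
                      Ck k' U (fun u => 'D_'e_i f u)
   else True).

(* Intended for open U. *)
Definition smooth_on (U : set 'rV[R]_n) (f : 'rV[R]_n -> R) : Prop :=
  forall k, Ck k U f.

End Smooth.

(* A connected (Hausdorff, second countable) smooth n-manifold, given by a
   smooth atlas. [cmap c] and [cinv c] are total functions, meaningful only on
   the chart domain [cdom c] and on its image, respectively. *)
Record manifold (R : realType) (n : nat) := Manifold {
  carrier :> topologicalType;
  chart : Type;
  cdom : chart -> set carrier;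
  cmap : chart -> carrier -> 'rV[R]_n;
  cinv : chart -> 'rV[R]_n -> carrier;
  manifold_hausdorff : hausdorff_space carrier;
  manifold_second_countable : @second_countable carrier;
  manifold_connected : connected [set: carrier];
  chart_cover : forall p, exists c, cdom c p;
  cdom_open : forall c, open (cdom c);
  cimg_open : forall c, open (cmap c @` cdom c);
  cmapK : forall c p, cdom c p -> cinv c (cmap c p) = p;
  cmap_continuous : forall c p, cdom c p -> {for p, continuous (cmap c)};
  cinv_continuous : forall c u,
    (cmap c @` cdom c) u -> {for u, continuous (cinv c)};
  chart_compatible : forall c c' (i : 'I_n),
    smooth_on (cmap c @` (cdom c `&` cdom c'))
              (fun u => cmap c' (cinv c u) ord0 i) }.

Section Geometry.
Variables (R : realType) (n : nat) (M : manifold R n).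
Implicit Types (c : chart M) (p x : M).

(* Coordinate partial derivative of f with respect to the k-th coordinate of
   the chart c, at a point p of its domain. *)
Definition pd c (k : 'I_n) (f : M -> R) p : R :=
  'D_'e_k (f \o cinv c) (cmap c p).

Definition jac c c' p : 'M[R]_n :=
  \matrix_(i < n, j < n) pd c j (fun q => cmap c' q ord0 i) p.

(* T_xM: families of components, one column for each chart around x, related
   by the contravariant transformation law. The components in charts whose
   domain does not contain x are irrelevant. *)
Record tangent x := Tangent {
  tcomp :> chart M -> 'cV[R]_n;
  tcomp_law : forall c c', cdom c x -> cdom c' x ->
    tcomp c' = jac c c' x *m tcomp c }.

Definition tangent_neq0 x (v : tangent x) : Prop :=
  exists2 c, cdom c x & tcomp v c != 0.

(* A smooth pseudo-Riemannian metric of arbitrary signature: [mcomp c p] is the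
   matrix of components g_{ij} in the chart c at the point p. *)
Record metric := Metric {
  mcomp :> chart M -> M -> 'M[R]_n;
  metric_sym : forall c p, cdom c p -> (mcomp c p)^T = mcomp c p;
  metric_nondegenerate : forall c p, cdom c p -> mcomp c p \in unitmx;
  metric_smooth : forall c (i j : 'I_n),
    smooth_on (cmap c @` cdom c) (fun u => mcomp c (cinv c u) i j);
  metric_law : forall c c' p, cdom c p -> cdom c' p ->
    mcomp c p = (jac c c' p)^T *m mcomp c' p *m jac c c' p }.

Section LeviCivita.
Variables (g : metric) (c : chart M).

(* The Levi-Civita connection coefficient Gamma^i_{jk} in the chart c. *)
Definition christoffel (i j k : 'I_n) p : R :=
  2^-1 * \sum_(l < n) invmx (g c p) i l *
    (pd c j (fun q => g c q l k) p + pd c k (fun q => g c q l j) p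
     - pd c l (fun q => g c q j k) p).

(* nabla_k V^j *)
Definition nabla_vec (V : 'I_n -> M -> R) (k j : 'I_n) p : R :=
  pd c k (V j) p + \sum_(m < n) christoffel j k m p * V m p.

(* nabla_l T_k^j *)
Definition nabla_11 (T : 'I_n -> 'I_n -> M -> R) (l k j : 'I_n) p : R :=
  pd c l (T k j) p + \sum_(m < n) christoffel j l m p * T k m p
  - \sum_(m < n) christoffel m l k p * T m j p.

Definition nabla2_vec (V : 'I_n -> M -> R) (l k j : 'I_n) p : R :=
  nabla_11 (nabla_vec V) l k j p.

(* R^i_{jkl}, read off from [nabla_k, nabla_l] V^i = R^i_{jkl} V^j by taking
   for V the j-th coordinate vector field, V^i = delta^i_j. *)
Definition riemann (i j k l : 'I_n) p : R :=
  let V := fun (i' : 'I_n) (_ : M) => (i' == j)%:R in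
  nabla2_vec V k l i p - nabla2_vec V l k i p.

Definition ricci (j k : 'I_n) p : R := \sum_(a < n) riemann a j a k p.

(* P_{jk} and P^i_j *)
Definition schouten (j k : 'I_n) p : R := (n.-1)%:R^-1 * ricci j k p.

Definition schouten_up (i j : 'I_n) p : R :=
  \sum_(k < n) invmx (g c p) i k * schouten k j p.

(* W^i_{jkl} *)
Definition weyl (i j k l : 'I_n) p : R :=
  riemann i j k l p + (i == l)%:R * schouten j k p
                    - (i == k)%:R * schouten j l p.

(* K^i_{jkl} *)
Definition constcurv (i j k l : 'I_n) p : R :=
  (i == l)%:R * g c p j k - (i == k)%:R * g c p j l.

End LeviCivita.

Definition open_interval (I : set R) : Prop :=
  [/\ open I, is_interval I & I !=set0].

(* gamma, restricted to the open interval I, is an affinely parametrised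
   geodesic of g. Solutions of the geodesic equation are automatically
   smooth, so only two derivatives are required. *)
Definition geodesic (g : metric) (I : set R) (gamma : R -> M) : Prop :=
  open_interval I /\
  forall t, I t ->
    {for t, continuous gamma} /\
    forall c, cdom c (gamma t) ->
      let X := fun (i : 'I_n) (s : R) => cmap c (gamma s) ord0 i in
      forall i : 'I_n,
        [/\ derivable (X i) t 1,
            derivable (derive1 (X i)) t 1
          & derive1n 2 (X i) t
            + \sum_(j < n) \sum_(k < n) christoffel g c i j k (gamma t)
                * derive1 (X j) t * derive1 (X k) t = 0].

(* phi is a diffeomorphism of the open interval J onto I; injectivity follows
   from the nonvanishing of its derivative. *)
Definition reparametrisation (J I : set R) (phi : R -> R) : Prop :=
  [/\ open_interval J, phi @` J = I,
      (forall k t, J t -> derivable (derive1n k phi) t 1)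
    & (forall t, J t -> derive1 phi t != 0)].

Definition geodesics_reparametrise (g h : metric) : Prop :=
  forall I gamma, geodesic g I gamma ->
    exists J phi, reparametrisation J I phi /\ geodesic h J (gamma \o phi).

Definition proj_equiv (g h : metric) : Prop :=
  geodesics_reparametrise g h /\ geodesics_reparametrise h g.

Definition metric_projective_structure (m : set metric) : Prop :=
  exists g0, m = [set g | proj_equiv g0 g].

(* W^i_{jkl} v^j = 0 at x. The projective Weyl tensor is common to all the
   metrics of m, so vanishing is asked for each of them, as well as in each
   chart. *)
Definition weyl_nullity (m : set metric) x (v : tangent x) : Prop :=
  forall g, m g -> forall c, cdom c x -> forall i k l : 'I_n,
    \sum_(j < n) weyl g c i j k l x * v c j ord0 = 0.

(* P^i_j v^j = B v^i at x *)
Definition schouten_eigen (g : metric) x (v : tangent x) (B : R) : Prop :=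
  forall c, cdom c x -> forall i : 'I_n,
    \sum_(j < n) schouten_up g c i j x * v c j ord0 = B * v c i ord0.

(* R^i_{jkl} v^j = - B v^j K^i_{jkl} at x *)
Definition curvature_nullity (g : metric) x (v : tangent x) (B : R) : Prop :=
  forall c, cdom c x -> forall i k l : 'I_n,
    \sum_(j < n) riemann g c i j k l x * v c j ord0 =
    - B * \sum_(j < n) v c j ord0 * constcurv g c i j k l x.

End Geometry.

(* Main.v *)
(* For v in the Weyl nullity of g, R^i_{jkl} v^j = delta^i_k p_l - delta^i_l p_k
   with p_l = P_{jl} v^j. Lowering i and contracting with v gives 0 on the left,
   hence v_k p_l = v_l p_k, so p is a multiple B of v_flat, and substituting it
   back gives R^i_{jkl} v^j = -B v^j K^i_{jkl}; B is the same in all charts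
   because Ric is a tensor. Contracting that identity gives p = B v_flat back
   and hence W^i_{jkl} v^j = 0 for that one metric g; to get it for the whole
   class, one needs the projective invariance of W. There, equivalence is only
   known through reparametrised geodesics. A geodesic through a given point
   with a given velocity V exists by Picard-Lindelof; comparing the two
   geodesic equations along it shows that the difference D of the Christoffel
   symbols satisfies D(V,V) = mu V for every V, which forces D^i_{jk} =
   delta^i_j Y_k + delta^i_k Y_j. Then the curvature changes by delta^i_l
   Q_{kj} - delta^i_k Q_{lj} + delta^i_j (Q_{kl} - Q_{lk}), and Q is symmetric
   since both Ricci tensors are, so that W is unchanged. *)

From HB Require Import structures.
Require Import Defs.
From mathcomp Require Import all_boot all_order all_algebra.
From mathcomp Require Import all_classical all_reals all_analysis.
From mathcomp Require Import ring lra.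
Import Order.TTheory GRing.Theory Num.Theory.
Import numFieldNormedType.Exports.

Set Implicit Arguments.
Unset Strict Implicit.
Unset Printing Implicit Defensive.

Local Open Scope classical_set_scope.
Local Open Scope ring_scope.

(** * Calculus of several variables *)

(** Two features of the definitions shape the proof. Smoothness is a condition on iterated partial
    derivatives along the axes, so Frechet differentiability, the chain rule and the symmetry of
    second derivatives are all drawn from the mean value theorem, applied one coordinate at a time.
    And a geodesic must satisfy its equation in every chart that meets it, whereas Picard iteration
    produces a curve in one chart; passing to the others takes the transformation law of the
    Christoffel symbols, which is read off from the uniqueness of the Levi-Civita connection. The
    same law, differentiated once, makes the curvature and the Ricci tensor tensorial. The
    connection is handled through the matrices [christoffel_mx], with the form index outside: the
    curvature is then d_k Gamma_l - d_l Gamma_k + [Gamma_k, Gamma_l], and a change of chart is a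
    pullback of the form index together with a gauge transformation by the Jacobian. *)

Section OneVariable.
Variable R : realType.

Lemma is_derive_line (V W : normedModType R) (f : V -> W) (u v : V) (t : R) d :
  is_derive (t *: v + u) v f d -> is_derive t 1 (fun s => f (s *: v + u)) d.
Proof.
have e : (fun h : R => h^-1 *: (((fun s => f (s *: v + u)) \o shift t) (h *: 1)
            - f (t *: v + u))) =
         (fun h => h^-1 *: ((f \o shift (t *: v + u)) (h *: v) - f (t *: v + u))).
  apply: funext => h /=; rewrite addrA -scalerDl.
  by have -> : h *: (1 : R) = h by exact: mulr1.
by case=> df Df; split; [rewrite /derivable e | rewrite /derive e].
Qed.

Lemma is_derive1_continuous (f : R -> R) (t d : R) :
  is_derive t 1 f d -> {for t, continuous f}.
Proof. by case=> /derivable1_diffP /differentiable_continuous. Qed.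

(** [Num.min] and [Num.max] allow either order of the endpoints, so that increments of both signs
    are covered. *)
Lemma dist_le_derive (f df : R -> R) (a b K : R) :
  (forall t, Num.min a b <= t <= Num.max a b ->
     is_derive t 1 f (df t) /\ `|df t| <= K) ->
  `|f b - f a| <= K * `|b - a|.
Proof.
wlog ab : a b / a <= b.
  move=> H; have [ab|/ltW ba] := leP a b.
    by have := H a b ab; rewrite (min_idPl ab) (max_idPr ab).
  by have := H b a ba; rewrite (min_idPl ba) (max_idPr ba) distrC (distrC a).
rewrite (min_idPl ab) (max_idPr ab) => h.
have [] := @MVT_segment R f df a b ab.
- move=> t; rewrite in_itv /= => /andP[at_ tb].
  by apply: (h t _).1; rewrite !ltW.
- apply: continuous_in_subspaceT => t; rewrite inE /= in_itv /= => th.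
  exact: is_derive1_continuous (h t th).1.
move=> c; rewrite in_itv /= => ch ->; rewrite normrM.
by apply: ler_wpM2r => //; exact: (h c ch).2.
Qed.

End OneVariable.

Section Box.
Variables (R : realType) (n : nat).
Implicit Types (u v w : 'rV[R]_n).

(** Stated coordinate by coordinate, so that altering one coordinate at a time visibly stays
    inside. *)
Definition box u0 (r : R) : set 'rV[R]_n :=
  [set u | forall i, `|u ord0 i - u0 ord0 i| < r].

Lemma nbhs_boxP u0 (P : set 'rV[R]_n) :
  nbhs u0 P <-> exists2 r, 0 < r & box u0 r `<=` P.
Proof.
split=> [/nbhs_ballP[r /= r0 rP]|[r r0 rP]].
  exists r => // u ur; apply: rP; split=> // i j.
  by rewrite (ord1 i) /= /ball /= distrC.
apply/nbhs_ballP; exists r => // u [_ ur]; apply: rP => i.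
by have := ur ord0 i; rewrite /ball /= distrC.
Qed.

Lemma box_norm u0 u (r : R) : 0 < r -> `|u - u0| < r -> box u0 r u.
Proof.
move=> r0 h i; apply: le_lt_trans h.
rewrite [leRHS]/Num.Def.normr /= mx_normrE.
by apply: le_trans (le_bigmax _ _ (ord0, i)); rewrite !mxE.
Qed.

Lemma coord_le_norm u i : `|u ord0 i| <= `|u|.
Proof.
rewrite [leRHS]/Num.Def.normr /= mx_normrE.
by apply: le_trans (le_bigmax _ _ (ord0, i)); rewrite ?mxE.
Qed.

Lemma partial_step_bound (f : 'rV[R]_n -> R) u0 r k K u h :
  box u0 r u -> box u0 r (h *: 'e_k + u) ->
  (forall w, box u0 r w -> derivable f w 'e_k /\ `|'D_'e_k f w| <= K) ->
  `|f (h *: 'e_k + u) - f u| <= K * `|h|.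
Proof.
move=> bu bh H.
have := @dist_le_derive R (fun s => f (s *: 'e_k + u))
  (fun s => 'D_'e_k f (s *: 'e_k + u)) 0 h K.
rewrite scale0r add0r subr0; apply=> t th.
have bt : box u0 r (t *: 'e_k + u).
  move=> i; have := bu i; have := bh i; rewrite !mxE !eqxx /=.
  case: (i == k); last by rewrite !mulr0 !add0r.
  rewrite !mulr1 !ltr_norml; move: th; case: (lerP 0 h) => h0; lra.
by have [d b] := H _ bt; split => //; apply: is_derive_line; exact: derivableP.
Qed.

(** Telescoping along the points [y m], whose first m coordinates are those of u and the others
    those of w: all of them lie in the box, and consecutive ones differ along a single axis. *)
Lemma partial_bound (f : 'rV[R]_n -> R) u0 r (K : 'I_n -> R) u w :
  (forall w, box u0 r w -> forall i, derivable f w 'e_i /\ `|'D_'e_i f w| <= K i) ->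
  box u0 r u -> box u0 r w ->
  `|f u - f w| <= \sum_i K i * `|u ord0 i - w ord0 i|.
Proof.
move=> H bu bw.
pose y m : 'rV[R]_n := \row_i (if (i < m)%N then u ord0 i else w ord0 i).
have by_ m : box u0 r (y m) by move=> i; rewrite mxE; case: ifP.
have ystep (k : 'I_n) : y k.+1 = (u ord0 k - w ord0 k) *: 'e_k + y k.
  apply/rowP => i; rewrite !mxE eqxx /= ltnS leq_eqVlt val_eqE.
  have [->|ik] := eqVneq i k; first by rewrite ltnn /= mulr1 subrK.
  by rewrite mulr0 add0r.
have main m : (m <= n)%N ->
    `|f (y m) - f w| <= \sum_(i < n | (i < m)%N) K i * `|u ord0 i - w ord0 i|.
  elim: m => [|m IH] mn.
    have -> : y 0%N = w by apply/rowP => i; rewrite mxE.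
    by rewrite subrr normr0 big_pred0.
  rewrite (bigD1 (Ordinal mn)) //= (_ : f _ - _ =
    (f (y m.+1) - f (y m)) + (f (y m) - f w)); last by ring.
  apply: le_trans (ler_normD _ _) _; apply: lerD.
    rewrite (ystep (Ordinal mn)) /=; apply: (partial_step_bound (by_ m)).
      by rewrite -(ystep (Ordinal mn)).
    by move=> z bz; exact: H.
  apply: le_trans (IH (ltnW mn)) _; rewrite le_eqVlt; apply/orP; left.
  apply/eqP; apply: eq_bigl => i.
  by rewrite -val_eqE /= ltnS [in RHS]leq_eqVlt; case: ltngtP.
have := main n (leqnn n).
have -> : y n = u by apply/rowP => i; rewrite mxE ltn_ord.
move=> h; apply: le_trans h _; rewrite le_eqVlt; apply/orP; left.
by apply/eqP; apply: eq_bigl => i; rewrite ltn_ord.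
Qed.

End Box.

Lemma differentiable_of_approx (R : numFieldType) (V W : normedModType R)
    (f : V -> W) (df : {linear V -> W}) (x : V) : continuous df ->
  (forall e, 0 < e ->
     \forall h \near 0, `|f (h + x) - f x - df h| <= e * `|h|) ->
  differentiable f x.
Proof.
move=> cdf H.
have eL : f \o shift x = cst (f x) + df +o_ 0 id.
  apply/eqaddoP => e e0; apply: filterS (H e e0) => h.
  by rewrite /= -![(_ + _ : _ -> _) _]/(_ + _) -![(- _ : _ -> _) _]/(- _) opprD addrA.
by apply/diff_locallyP; rewrite (diff_unique cdf eL).
Qed.

Lemma cvg_sum_real (R : realType) (T : Type) (F : set_system T) (I : Type)
    (r : seq I) (P : pred I) (f : I -> T -> R) (a : I -> R) : Filter F ->
  (forall i, f i x @[x --> F] --> a i) ->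
  \sum_(i <- r | P i) f i x @[x --> F] --> \sum_(i <- r | P i) a i.
Proof. by move=> FF h; apply: cvg_big => //; exact: add_continuous. Qed.

Section Ck.
Variables (R : realType) (n : nat).
Implicit Types (U : set 'rV[R]_n) (f g : 'rV[R]_n -> R) (u : 'rV[R]_n).

Lemma near_open U u (P : 'rV[R]_n -> Prop) : open U -> U u ->
  (forall w, U w -> P w) -> \forall w \near u, P w.
Proof. by move=> oU Uu H; apply: filterS (open_nbhs_nbhs (conj oU Uu)). Qed.

Lemma continuous_ext U f g u : open U -> (forall w, U w -> f w = g w) -> U u ->
  {for u, continuous f} -> {for u, continuous g}.
Proof.
move=> oU fg Uu cf; rewrite /prop_for /continuous_at -(fg _ Uu).
apply: cvg_trans cf; apply: (@near_eq_cvg _ _ (nbhs u) (nbhs_filter u)).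
exact: (near_open oU Uu fg).
Qed.

Lemma Ck_ext k U f g : open U -> (forall u, U u -> f u = g u) ->
  Ck k U f -> Ck k U g.
Proof.
move=> oU; elim: k f g => [|k IH] f g fg [cf df].
  by split=> // u Uu; exact: continuous_ext fg Uu (cf u Uu).
split=> [u Uu|i]; first exact: continuous_ext fg Uu (cf u Uu).
split=> [u Uu|].
  exact: near_eq_derivable (near_open oU Uu fg) ((df i).1 u Uu).
apply: IH (df i).2 => u Uu; exact: near_eq_derive (near_open oU Uu fg).
Qed.

Lemma Ck_subset k U V f : V `<=` U -> Ck k U f -> Ck k V f.
Proof.
move=> VU; elim: k f => [|k IH] f [cf df]; first by split=> // u /VU/cf.
split=> [u /VU/cf//|i]; split=> [u /VU/(df i).1//|]; exact: IH (df i).2.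
Qed.

Lemma CkW k U f : Ck k.+1 U f -> Ck k U f.
Proof.
elim: k f => [|k IH] f [cf df]; split=> // i; split; first exact: (df i).1.
exact: IH (df i).2.
Qed.

Lemma Ck_cst k U (a : R) : Ck k U (cst a).
Proof.
elim: k a => [|k IH] a; first by split=> // u _; exact: cst_continuous.
split=> [u _|i]; first exact: cst_continuous.
split=> [u _|]; first exact: derivable_cst.
rewrite (_ : (fun _ => _) = cst 0) //.
by apply: funext => u; rewrite derive_cst.
Qed.

Lemma CkD k U f g : open U -> Ck k U f -> Ck k U g -> Ck k U (f \+ g).
Proof.
move=> oU; elim: k f g => [|k IH] f g [cf df] [cg dg].
  by split=> // u Uu; apply: continuousD; [exact: cf|exact: cg].
split=> [u Uu|i]; first by apply: continuousD; [exact: cf|exact: cg].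
have [dfi Df] := df i; have [dgi Dg] := dg i.
split=> [u Uu|]; first by apply: derivableD; [exact: dfi|exact: dgi].
apply: Ck_ext (IH _ _ Df Dg) => // u Uu.
by rewrite [RHS]deriveD //; [exact: dfi|exact: dgi].
Qed.

Lemma CkM k U f g : open U -> Ck k U f -> Ck k U g -> Ck k U (f \* g).
Proof.
move=> oU; elim: k f g => [|k IH] f g Cf Cg.
  by split=> // u Uu; apply: continuousM; [exact: Cf.1|exact: Cg.1].
split=> [u Uu|i]; first by apply: continuousM; [exact: Cf.1|exact: Cg.1].
have [dfi Df] := Cf.2 i; have [dgi Dg] := Cg.2 i.
split=> [u Uu|]; first by apply: derivableM; [exact: dfi|exact: dgi].
apply: Ck_ext (CkD oU (IH _ _ (CkW Cf) Dg) (IH _ _ (CkW Cg) Df)) => // u Uu.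
by rewrite [RHS]deriveM //; [exact: dfi|exact: dgi].
Qed.

Lemma CkV k U f : open U -> (forall u, U u -> f u != 0) ->
  Ck k U f -> Ck k U (fun u => (f u)^-1).
Proof.
move=> oU f0; elim: k => [|k IH] Cf.
  by split=> // u Uu; apply: continuousV; [exact: f0|exact: Cf.1].
split=> [u Uu|i]; first by apply: continuousV; [exact: f0|exact: Cf.1].
have [dfi Df] := Cf.2 i; have IHf := IH (CkW Cf).
split=> [u Uu|]; first by apply: derivableV; [exact: f0|exact: dfi].
apply: Ck_ext (CkM oU (CkM oU (Ck_cst k U (-1)) (CkM oU IHf IHf)) Df) => // u Uu.
rewrite [RHS]deriveV ?f0 //=; last exact: dfi.
by rewrite /GRing.scale /= mulN1r expr2 invfM.
Qed.

Lemma Ck_sum k U (I : Type) (r : seq I) (P : pred I) (F : I -> 'rV[R]_n -> R) :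
  open U -> (forall i, Ck k U (F i)) ->
  Ck k U (fun u => \sum_(i <- r | P i) F i u).
Proof.
move=> oU CF; elim: r => [|i r IH].
  apply: Ck_ext (Ck_cst k U 0) => // u _; by rewrite big_nil.
case Pi : (P i).
  by apply: Ck_ext (CkD oU (CF i) IH) => // u _; rewrite big_cons Pi.
by apply: Ck_ext IH => // u _; rewrite big_cons Pi.
Qed.

Lemma Ck_prod k U (I : Type) (r : seq I) (P : pred I) (F : I -> 'rV[R]_n -> R) :
  open U -> (forall i, Ck k U (F i)) ->
  Ck k U (fun u => \prod_(i <- r | P i) F i u).
Proof.
move=> oU CF; elim: r => [|i r IH].
  apply: Ck_ext (Ck_cst k U 1) => // u _; by rewrite big_nil.
case Pi : (P i).
  by apply: Ck_ext (CkM oU (CF i) IH) => // u _; rewrite big_cons Pi.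
by apply: Ck_ext IH => // u _; rewrite big_cons Pi.
Qed.


(** Subtracting the candidate differential L leaves a function whose partial derivatives vanish at
    u, hence are small nearby by continuity; [partial_bound] turns this into the little-o
    estimate. *)
Lemma Ck1_differentiable U f u : open U -> Ck 1 U f -> U u -> differentiable f u.
Proof.
move=> oU Cf Uu.
pose L (h : 'rV[R]_n) : R := \sum_i h ord0 i * 'D_'e_i f u.
have linL : linear L.
  move=> a x y; rewrite /L scaler_sumr -big_split /=; apply: eq_bigr => i _.
  by rewrite !mxE /GRing.scale /= mulrDl mulrA.
pose LL : {linear 'rV[R]_n -> R} := HB.pack L (GRing.isLinear.Build _ _ _ _ L linL).
have cL : continuous LL.
  move=> w; apply: (cvg_sum_real (nbhs_filter w)).
  by move=> i; apply: cvgM; [exact: coord_continuous|exact: cvg_cst].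
apply: (@differentiable_of_approx _ _ _ f LL) => // e e0.
  (* The n coordinates contribute e' each; dividing by n + 1 instead of n also covers n = 0. *)
  pose e' := e / (n.+1)%:R.
  have e'0 : 0 < e' by rewrite divr_gt0.
  have : \forall w \near u, U w /\ forall i, `|'D_'e_i f w - 'D_'e_i f u| < e'.
    near=> w; split; first by near: w; exact: open_nbhs_nbhs.
    near: w; apply: (@filter_forall _ _ _ _ (nbhs_filter u)) => i.
    have := (Cf.2 i).2.1 u Uu.
    by move=> /cvgrPdist_lt /(_ e' e'0); apply: filterS => w; rewrite distrC.
  move=> /nbhs_boxP[r r0 H].
  have Nr : \forall h \near (0 : 'rV[R]_n), `|h| < r by exact: nbhs0_lt.
  near=> h.
  have bh : box u r (h + u).
    by apply: box_norm => //; rewrite addrK; near: h; exact: Nr.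
  have LD w i : is_derive w 'e_i L ('D_'e_i f u).
    have dL : differentiable LL w by exact: linear_differentiable.
    split; first exact: diff_derivable.
    rewrite (_ : L = LL) // deriveE // diff_lin // /LL /= /L (bigD1 i) //= big1.
      by rewrite mxE !eqxx mul1r addr0.
    by move=> j ji; rewrite mxE eqxx (negbTE ji) mul0r.
  have := @partial_bound R n (f \- L) u r (fun=> e') (h + u) u _ bh.
  have -> : (f \- L) (h + u) - (f \- L) u = f (h + u) - f u - LL h.
    rewrite /= (_ : L (h + u) = L h + L u); last exact: (raddfD LL).
    by rewrite /LL /=; ring.
  move=> H'; apply: le_trans (H' _ _) _.
  - move=> w bw i; have [Uw Dw] := H w bw; have [dLw DLw] := LD w i.
    have dfw : derivable f w 'e_i by apply: (Cf.2 i).1.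
    split; first exact: derivableB.
    by rewrite deriveB // DLw ltW.
  - by move=> i; rewrite subrr normr0.
  - rewrite -mulr_sumr /e' -mulrA ler_pM2l // ler_pdivrMl // .
    apply: le_trans (_ : \sum_(i < n) `|h| <= _).
      by apply: ler_sum => i _; rewrite mxE addrK coord_le_norm.
    by rewrite sumr_const card_ord -[`|h| *+ n]mulr_natl ler_wpM2r // ler_nat.
Unshelve. all: by end_near. Qed.

(** Restricting to the line through p along v makes the inner map a function of one real variable,
    for which derivability is differentiability. So g has to be derivable in the direction v
    only. *)
Lemma derive_compE (V : normedModType R) (g : V -> 'rV[R]_n) f (p v : V) :
  differentiable f (g p) -> derivable g p v ->
  is_derive p v (f \o g)
    (\sum_i 'D_'e_i f (g p) * 'D_v (fun q => g q ord0 i) p).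
Proof.
move=> df dg.
pose c s := g (s *: v + p).
have dc : differentiable c 0 by apply/derivable1_diffP; exact: (derivable1P g p v).1.
have c0 : c 0 = g p by rewrite /c scale0r add0r.
have dfc0 : differentiable f (c 0) by rewrite c0.
have dfc : differentiable (f \o c) 0 by exact: differentiable_comp.
have dfg : derivable (f \o g) p v.
  by apply: (derivable1P (f \o g) p v).2; exact: (diff_derivable dfc).
split=> //.
have line (W : normedModType R) (F : V -> W) : derivable F p v ->
    'D_v F p = 'D_1 (fun s : R => F (s *: v + p)) 0.
  move=> dF; have := @is_derive_line R V W F p v 0 ('D_v F p).
  rewrite scale0r add0r => /(_ (derivableP dF)) [_ ->].
  by [].
rewrite (line _ _ dfg) (deriveE _ dfc) (diff_comp dc dfc0) /= -(deriveE _ dc).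
rewrite -(line _ _ dg) c0 (derive_mx dg); set w := \matrix_(_, _) _.
have -> : w = \sum_i w ord0 i *: 'e_i.
  by rewrite {1}[w]row_sum_delta.
rewrite linear_sum; apply: eq_bigr => i _.
by rewrite linearZ /= deriveE // mxE /GRing.scale /= mulrC.
Qed.

End Ck.

Lemma is_derive_mulr (R : realType) (a t : R) : is_derive t 1 (fun s => s * a) a.
Proof.
rewrite (_ : (fun s => s * a) = a \*: (@id R)); last first.
  by apply: funext => s; rewrite /GRing.scale /= mulrC.
by apply: is_derive_eq; rewrite /GRing.scale /= mulr1.
Qed.

(** * Symmetry of second partial derivatives *)

Section Schwarz.
Variables (R : realType) (n : nat).
Implicit Types (U : set 'rV[R]_n) (f g : 'rV[R]_n -> R) (u : 'rV[R]_n).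

Lemma differentiable_approx (V W : normedModType R) (f : V -> W) x :
  differentiable f x -> forall e, 0 < e ->
  \forall h \near 0, `|f (h + x) - f x - 'd f x h| <= e * `|h|.
Proof.
move=> /diff_locallyP[_ /eqaddoP H] e e0; apply: filterS (H e e0) => h.
by rewrite /= -![(_ + _ : _ -> _) _]/(_ + _) -![(- _ : _ -> _) _]/(- _) opprD addrA.
Qed.

(* The mean value bound is applied to t |-> f(u + h e_i + t e_j) - f(u + t e_j)
   - t h D_i D_j f(u), whose derivative is o(h) as D_j f is differentiable at u. *)
Lemma second_difference U f u (i j : 'I_n) : open U -> Ck 2 U f -> U u ->
  i != j -> forall e, 0 < e -> exists2 r, 0 < r & forall h : R, 0 < h < r ->
  `|f (h *: 'e_j + (h *: 'e_i + u)) - f (h *: 'e_i + u) - f (h *: 'e_j + u) + f u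
    - h * h * 'D_'e_i ('D_'e_j f) u| <= e * (h * h).
Proof.
move=> oU Cf Uu ij e e0; have [dfj CG] := Cf.2 j.
pose G := 'D_'e_j f.
have dG : differentiable G u by exact: Ck1_differentiable CG Uu.
have e2 : 0 < e / 2 by rewrite divr_gt0.
have NU : \forall h \near (0 : 'rV[R]_n), U (h + u).
  have := near_open oU Uu (P := U) (fun _ => id).
  by rewrite (near_shift 0) /=; apply: filterS => h; rewrite /= subr0.
have N := filterI NU (differentiable_approx dG e2).
have [r r0 H] := (nbhs_boxP 0 _).1 (N (nbhs_filter _)).
exists r => // h /andP[h0 hr].
have normh (s t : R) : `|s| <= h -> `|t| <= h ->
    box 0 r (t *: 'e_j + s *: 'e_i) /\ `|t *: 'e_j + s *: 'e_i : 'rV[R]_n| <= h.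
  move=> sh th.
  have K (k : 'I_n) : `|(t *: 'e_j + s *: 'e_i : 'rV[R]_n) ord0 k| <= h.
    rewrite !mxE eqxx /=; have [->|_] := eqVneq k j.
      by rewrite eq_sym (negbTE ij) mulr0 mulr1 addr0.
    by case: (k == i); rewrite mulr0 add0r ?mulr0 ?mulr1 ?normr0 // ltW.
  split; first by move=> k; rewrite [(0 : 'rV[R]_n) ord0 k]mxE subr0 (le_lt_trans (K k)).
  rewrite /Num.Def.normr /= mx_normrE; apply: bigmax_le => [|[a k] _]; first exact: ltW.
  by rewrite /= (ord1 a).
pose A := 'D_'e_i G u.
pose psi (t : R) := f (t *: 'e_j + (h *: 'e_i + u)) - f (t *: 'e_j + u) - t * (h * A).
pose dpsi (t : R) := G (t *: 'e_j + (h *: 'e_i + u)) - G (t *: 'e_j + u) - h * A.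
have psiB t : Num.min 0 h <= t <= Num.max 0 h ->
    is_derive t 1 psi (dpsi t) /\ `|dpsi t| <= e * h.
  rewrite (min_idPl (ltW h0)) (max_idPr (ltW h0)) => /andP[t0 th].
  have tn : `|t| <= h by rewrite ger0_norm.
  have hn : `|h| <= h by rewrite gtr0_norm.
  have n0 : `|0 : R| <= h by rewrite normr0 ltW.
  have [b1 B1] := normh h t hn tn; have [b2 B2] := normh 0 t n0 tn.
  have [U1 G1] := H _ b1; have [U2 G2] := H _ b2.
  rewrite scale0r addr0 in U2 G2 B2; rewrite -addrA in U1 G1.
  split.
    rewrite /psi; apply: is_deriveB; last first.
      exact: is_derive_mulr.
    by apply: is_deriveB; apply: is_derive_line; exact/derivableP/dfj.
  have dGE : 'd G u (t *: 'e_j + h *: 'e_i) = 'd G u (t *: 'e_j) + h * A.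
    by rewrite linearD [X in _ + X]linearZ /A deriveE.
  rewrite dGE in G1.
  rewrite (_ : dpsi t = (G (t *: 'e_j + (h *: 'e_i + u)) - G u - ('d G u (t *: 'e_j) + h * A))
    - (G (t *: 'e_j + u) - G u - 'd G u (t *: 'e_j))); last by rewrite /dpsi; ring.
  apply: le_trans (ler_normB _ _) _; rewrite (splitr e) mulrDl.
  apply: lerD; [apply: le_trans G1 _|apply: le_trans G2 _]; by rewrite ler_pM2l.
have := dist_le_derive psiB.
rewrite /psi !scale0r !add0r mul0r subr0 subr0 (gtr0_norm h0) -mulrA.
by congr (`| _ | <= _); rewrite /A /G; ring.
Qed.

(** The second difference is symmetric in i and j, so for small h both mixed derivatives, times
    [h * h], lie within [e / 2 * (h * h)] of the same number. *)
Lemma Schwarz U f u (i j : 'I_n) : open U -> Ck 2 U f -> U u ->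
  'D_'e_i ('D_'e_j f) u = 'D_'e_j ('D_'e_i f) u.
Proof.
move=> oU Cf Uu; have [->//|ij] := eqVneq i j.
set a := LHS; set b := RHS.
apply/eqP; rewrite -subr_eq0 -normr_le0; apply/ler_addgt0Pl => e e0; rewrite addr0.
have e2 : 0 < e / 2 by rewrite divr_gt0.
have [r1 r10 H1] := second_difference oU Cf Uu ij e2.
have ji : j != i by rewrite eq_sym.
have [r2 r20 H2] := second_difference oU Cf Uu ji e2.
pose h := Num.min r1 r2 / 2.
have m0 : 0 < Num.min r1 r2 by rewrite lt_min r10.
have h0 : 0 < h by rewrite divr_gt0.
have hm : h < Num.min r1 r2 by rewrite ltr_pdivrMr // ltr_pMr // ltr1n.
move: (hm); rewrite lt_min => /andP[hr1 hr2].
have {H1} := H1 h; rewrite h0 hr1 => /(_ isT) H1.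
have {H2} := H2 h; rewrite h0 hr2 => /(_ isT) H2.
have hh : 0 < h * h by rewrite mulr_gt0.
rewrite -(ler_pM2l hh) -{1}(gtr0_norm hh) -normrM.
set D1 := _ + f u in H1; set D2 := _ + f u in H2.
have D12 : D1 = D2 by rewrite /D1 /D2 addrCA; ring.
rewrite -D12 -/b in H2; rewrite -/a in H1.
rewrite (_ : h * h * (a - b) = (D1 - h * h * b) - (D1 - h * h * a)); last by ring.
apply: le_trans (ler_normB _ _) _; apply: le_trans (lerD H2 H1) _.
by rewrite -mulrDl -splitr mulrC.
Qed.
End Schwarz.

Section Composition.
Variables (R : realType) (n : nat).
Implicit Types (U V : set 'rV[R]_n) (f : 'rV[R]_n -> R).

Lemma continuous_coords (T : topologicalType) (F : T -> 'rV[R]_n) x :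
  (forall i, {for x, continuous (fun y => F y ord0 i)}) -> {for x, continuous F}.
Proof.
move=> H P /nbhs_boxP[r r0 rP].
have N : \forall y \near x, forall i, `|F y ord0 i - F x ord0 i| < r.
  apply: filter_forall => i; have /cvgrPdist_lt /(_ r r0) := H i.
  by apply: filterS => y; rewrite distrC.
by apply: filterS N => y Hy; exact: rP.
Qed.

Lemma smooth_derivable U f u i : smooth_on U f -> U u -> derivable f u 'e_i.
Proof. by move=> /(_ 1%N)[_ /(_ i)[d _]] /d. Qed.

Lemma smooth_differentiable U f u :
  open U -> smooth_on U f -> U u -> differentiable f u.
Proof. by move=> oU sf; exact: Ck1_differentiable (sf 1%N). Qed.

Lemma smooth_derive U f i : smooth_on U f -> smooth_on U ('D_'e_i f).
Proof. by move=> sf k; exact: ((sf k.+1).2 i).2. Qed.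

Lemma smooth_coords_derivable U (T : 'rV[R]_n -> 'rV[R]_n) u i :
  (forall a, smooth_on U (fun w => T w ord0 a)) -> U u -> derivable T u 'e_i.
Proof.
move=> sT Uu; apply/derivable_mxP => b a; rewrite (ord1 b).
exact: smooth_derivable (sT a) Uu.
Qed.

(** Induction on the order for all f at once: by the chain rule the partial derivatives of f \o T
    are sums of products of ('D_'e_a f) \o T, which is covered at the lower order, with derivatives
    of the components of T. *)
Lemma smooth_comp U V f (T : 'rV[R]_n -> 'rV[R]_n) : open U -> open V ->
  (forall a, smooth_on V (fun w => T w ord0 a)) -> (forall w, V w -> U (T w)) ->
  smooth_on U f -> smooth_on V (f \o T).
Proof.
move=> oU oV sT VU sf k.
have cfT h w : smooth_on U h -> V w -> {for w, continuous (h \o T)}.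
  move=> sh Vw; apply: continuous_comp; last exact: (sh 0%N).1 (VU _ Vw).
  by apply: continuous_coords => a; exact: (sT a 0%N).1.
elim: k f sf => [|k IH] f sf.
  by split=> // w Vw; exact: (cfT _ _ sf Vw).
split=> [w Vw|i]; first exact: (cfT _ _ sf Vw).
have D w : V w -> is_derive w 'e_i (f \o T)
    (\sum_a 'D_'e_a f (T w) * 'D_'e_i (fun q => T q ord0 a) w).
  move=> Vw; apply: derive_compE; first exact: smooth_differentiable sf (VU _ Vw).
  exact: smooth_coords_derivable sT Vw.
split=> [w /D[]//|].
apply: (@Ck_ext _ _ k V
    (fun w => \sum_a 'D_'e_a f (T w) * 'D_'e_i (fun q => T q ord0 a) w)) => //.
  by move=> w /D[_ ->].
apply: Ck_sum => // a; apply: CkM => //; last exact: smooth_derive.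
exact: IH (smooth_derive _ sf).
Qed.

End Composition.

(** * The Picard-Lindelof theorem *)

Section Limits.
Variable R : realType.

Lemma exists_geometric_lt (C e : R) : 0 < e -> exists k, C / 2 ^+ k < e.
Proof.
move=> e0; pose k := Num.bound (C / e).
exists k; rewrite ltr_pdivrMr ?exprn_gt0 // mulrC -ltr_pdivrMr //.
have : C / e < k%:R.
  have [h|h] := leP 0 (C / e); first exact: archi_boundP.
  exact: lt_le_trans h (ler0n _ _).
move=> /lt_trans; apply.
by rewrite -natrX ltr_nat ltn_expl.
Qed.

Lemma le0_geometric (x C : R) : (forall k, x <= C / 2 ^+ k) -> x <= 0.
Proof.
move=> H; rewrite leNgt; apply/negP => /(exists_geometric_lt C)[k].
by rewrite ltNge H.
Qed.

(* u k - 2 C / 2^k is nondecreasing and u k + 2 C / 2^k is nonincreasing. *)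
Lemma geometric_limit (u : nat -> R) (C : R) :
  (forall k, `|u k.+1 - u k| <= C / 2 ^+ k) ->
  exists l, forall k, `|u k - l| <= 2 * C / 2 ^+ k.
Proof.
move=> H.
pose d k : R := 2 * C / 2 ^+ k.
have dS k : d k = d k.+1 + C / 2 ^+ k.
  rewrite /d exprS; have : (2 : R) ^+ k != 0 by rewrite expf_neq0.
  by move=> ?; field.
have C0 : 0 <= C by have := le_trans (normr_ge0 _) (H 0%N); rewrite expr0 divr1.
have d0 k : 0 <= d k by rewrite divr_ge0 ?exprn_ge0 // mulr_ge0.
have up m k : u k - d k <= u (m + k)%N - d (m + k)%N.
  elim: m => [//|m IH]; apply: le_trans IH _; rewrite addSn.
  by have := H (m + k)%N; rewrite (dS (m + k)%N) ler_norml => /andP[? ?]; lra.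
have dn m k : u (m + k)%N + d (m + k)%N <= u k + d k.
  elim: m => [//|m IH]; apply: le_trans _ IH; rewrite addSn.
  by have := H (m + k)%N; rewrite (dS (m + k)%N) ler_norml => /andP[? ?]; lra.
have ab k m : u k - d k <= u m + d m.
  have h1 := up m k; have h2 := dn k m; rewrite addnC in h1.
  by have := d0 (k + m)%N; lra.
pose S := range (fun k => u k - d k).
have ubS m : ubound S (u m + d m) by move=> _ [k _ <-].
have hS : has_sup S by split; [exists (u 0%N - d 0%N), 0%N|exists (u 0%N + d 0%N)].
exists (sup S) => k; rewrite -/(d k) ler_norml.
have h1 : u k - d k <= sup S by apply: (ub_le_sup hS.2); exists k.
have h2 : sup S <= u k + d k by apply: ge_sup (ubS k); exact: hS.1.
by apply/andP; split; lra.
Qed.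

Lemma geometric_limit_continuous (T : topologicalType) (F : nat -> T -> R)
    (f : T -> R) (C : R) :
  (forall k t, `|F k t - f t| <= C / 2 ^+ k) ->
  (forall k, continuous (F k)) -> continuous f.
Proof.
move=> H cF t; apply/cvgrPdist_lt => e e0.
have e3 : 0 < e / 3 by rewrite divr_gt0.
have [k Ck] := exists_geometric_lt C e3.
have /cvgrPdist_lt /(_ _ e3) := cF k t; apply: filterS => s.
have := H k t; have := H k s.
rewrite !ler_norml !ltr_norml => /andP[? ?] /andP[? ?] /andP[? ?].
by apply/andP; split; lra.
Qed.

End Limits.

Section Clamp.
Variable R : realType.
Implicit Types a b s t : R.

Definition clamp a b t := Num.max a (Num.min t b).

Lemma clamp_in a b t : a <= b -> a <= clamp a b t <= b.
Proof. by move=> ab; rewrite /clamp le_max lexx ge_max ge_min lexx orbT ab. Qed.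

Lemma clamp_id a b t : a <= t <= b -> clamp a b t = t.
Proof. by move=> /andP[h1 h2]; rewrite /clamp (min_idPl h2) (max_idPr h1). Qed.

Lemma clamp_lipschitz a b s t : a <= b -> `|clamp a b s - clamp a b t| <= `|s - t|.
Proof.
move=> ab; wlog st : s t / s <= t.
  move=> H; have [st|/ltW ts] := leP s t; first exact: H.
  by rewrite distrC (distrC s); exact: H.
rewrite distrC (distrC s) (ger0_norm (_ : 0 <= t - s)) ?subr_ge0 //.
rewrite /clamp /Num.max /Num.min ler_norml.
by repeat case: ifP => [|/negbT]; rewrite -?leNgt => *; apply/andP; split; lra.
Qed.

Lemma clamp_continuous a b : a <= b -> continuous (clamp a b).
Proof.
move=> ab t; apply/cvgrPdist_lt => e e0.
apply: filterS (nbhsx_ballx t e e0) => s; apply: le_lt_trans.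
exact: clamp_lipschitz.
Qed.

End Clamp.

Section Primitive.
Variable R : realType.
Implicit Type f : R -> R.

(* A primitive of f on [-1, +oo[ only: a fixed lower bound below 0 makes 0 an
   interior point, which is all that a local solution needs. *)
Definition primitive f (t : R) : R :=
  \int[lebesgue_measure]_(s in `[-1, t]) f s
    - \int[lebesgue_measure]_(s in `[-1, 0]) f s.

Lemma primitive0 f : primitive f 0 = 0.
Proof. exact: subrr. Qed.

Lemma is_derive_primitive f (t : R) : continuous f -> -1 < t < 1 ->
  is_derive t 1 (primitive f) (f t).
Proof.
move=> cf /andP[t1 t2].
have int : lebesgue_measure.-integrable `[-1, 1 : R] (EFin \o f).
  apply: continuous_compact_integrable; first exact: segment_compact.
  exact: continuous_subspaceT.
have [dF DF] := continuous_FTC1_closed t2 int t1 (cf t).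
set F := (fun _ => _) in dF DF.
have dF' : is_derive t 1 F (f t) by split; [exact: dF|rewrite -derive1E].
have := is_deriveB dF' (is_derive_cst (F 0) t 1).
by rewrite subr0.
Qed.

End Primitive.

Section Picard.
Variables (R : realType) (I : finType) (F : (I -> R) -> I -> R) (L : R).
Hypothesis L1 : 1 <= L.
Hypothesis lipF : forall u w d, (forall j, `|u j - w j| <= d) ->
  forall i, `|F u i - F w i| <= L * d.
Variable y0 : I -> R.
Implicit Types y z : I -> R -> R.

(** With this half-width the Picard map contracts by L * T = 1/2, and [1 <= L] gives T < 1, so that
    all clamped times lie where [primitive] is known to be differentiable. *)
Let T := (2 * L)^-1.
Let clamp t := clamp (- T) T t.

Let T0 : 0 < T. Proof. by rewrite invr_gt0 mulr_gt0 // (lt_le_trans ltr01). Qed.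

Let T1 : T < 1.
Proof. by have L1' := L1; rewrite invf_lt1; lra. Qed.

Let T2 : - T <= T. Proof. by have T0' := T0; lra. Qed.

Let clampT t : - T <= clamp t <= T.
Proof. exact: clamp_in T2. Qed.

Let clampTE t : `|t| < T -> clamp t = t.
Proof. by rewrite ltr_norml => /andP[? ?]; rewrite /clamp clamp_id // !ltW. Qed.

Let continuous_clamp : continuous clamp.
Proof. exact: clamp_continuous T2. Qed.

(* Clamping the time keeps all the iterates defined and continuous on the
   whole line, with estimates that are uniform in t. *)
Let step y : I -> R -> R :=
  fun i t => y0 i + primitive (fun s => F (fun j => y j s) i) (clamp t).

Let continuous_field y i : (forall j, continuous (y j)) ->
  continuous (fun s => F (fun j => y j s) i).
Proof.
move=> cy t; apply/cvgrPdist_le => e e0.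
have L0 : 0 < L by exact: lt_le_trans ltr01 L1.
have eL : 0 < e / L by rewrite divr_gt0.
have N : \forall s \near t, forall j, `|y j t - y j s| <= e / L.
  apply: (@filter_forall _ _ _ _ (nbhs_filter t)) => j.
  by have /cvgrPdist_le /(_ _ eL) := cy j t.
by apply: filterS N => s /lipF /(_ i); rewrite mulrC divfK // gt_eqF.
Qed.

Let in_unit t : - T <= t <= T -> -1 < t < 1.
Proof. by have T1' := T1; move=> /andP[? ?]; apply/andP; split; lra. Qed.

Let continuous_step y i : (forall j, continuous (y j)) -> continuous (step y i).
Proof.
move=> cy t; pose g s := F (fun j => y j s) i.
have cp : {for clamp t, continuous (primitive g)}.
  have := is_derive_primitive (continuous_field (i := i) cy) (in_unit (clampT t)).
  exact: is_derive1_continuous.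
have cpc := continuous_comp (@continuous_clamp t) cp.
exact: (cvgD (cvg_cst (y0 i)) cpc).
Qed.

Let primitive_dist f g d t : continuous f -> continuous g ->
  (forall s, `|f s - g s| <= d) -> - T <= t <= T ->
  `|primitive f t - primitive g t| <= d * T.
Proof.
move=> cf cg fg tT.
have := @dist_le_derive R (primitive f \- primitive g) (f \- g) 0 t d.
rewrite /= !primitive0 !subr0 => h; apply: le_trans (h _) _.
  move=> s hs; split=> //; apply: is_deriveB; apply: is_derive_primitive => //;
  apply: in_unit; move: tT hs T0 => /andP[? ?];
  by case: (leP 0 t) => ? /andP[? ?] ?; apply/andP; split; lra.
apply: ler_wpM2l; last by rewrite ler_norml.
exact: le_trans (fg 0).
Qed.

Let step_dist y z d : (forall j, continuous (y j)) -> (forall j, continuous (z j)) ->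
  (forall j t, `|y j t - z j t| <= d) ->
  forall i t, `|step y i t - step z i t| <= d / 2.
Proof.
move=> cy cz yz i t; rewrite /step opprD addrACA subrr add0r.
apply: le_trans (primitive_dist (d := L * d) _ _ _ (clampT t)) _.
- exact: continuous_field.
- exact: continuous_field.
- by move=> s; apply: lipF => j.
have L0 : L != 0 by rewrite gt_eqF // (lt_le_trans ltr01).
by rewrite le_eqVlt; apply/orP; left; apply/eqP; rewrite /T; field.
Qed.

Let Y k : I -> R -> R := iter k step (fun i _ => y0 i).

Let continuous_Y k i : continuous (Y k i).
Proof.
by elim: k i => [|k IH] i; [exact: cst_continuous|exact: continuous_step].
Qed.

(** The iterates converge geometrically and uniformly in t, so the limit is continuous and fixed by
    [step]. For |t| < T the clamp is the identity, and the fundamental theorem of calculus turns the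
    fixed point equation into the differential equation. *)
Lemma Picard_Lindelof_ge1 : exists2 e : R, 0 < e & exists y, (forall i, y i 0 = y0 i) /\
  forall t : R, `|t| < e -> forall i, is_derive t 1 (y i) (F (fun j => y j t) i).
Proof.
(* The first iterate moves by at most |F y0 i| times |clamp t|, and |clamp t| is below 1. *)
pose C : R := \sum_i `|F y0 i|.
have FC i : `|F y0 i| <= C.
  by rewrite /C (bigD1 i) //= lerDl sumr_ge0.
have Y1 k i t : `|Y k.+1 i t - Y k i t| <= C / 2 ^+ k.
  elim: k i t => [|k IH] i t; last first.
    rewrite exprSr invfM mulrA.
    exact: step_dist (@continuous_Y k.+1) (@continuous_Y k) IH i t.
  rewrite expr0 divr1 /Y /= /step addrC addKr.
  set p := primitive _; have p0 : p 0 = 0 by exact: primitive0.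
  have := @dist_le_derive R p (cst (F y0 i)) 0 (clamp t) C.
  rewrite p0 !subr0 => h; apply: le_trans (h _) _.
    move=> s hs; split; last exact: FC.
    apply: is_derive_primitive; first exact: cst_continuous.
    apply: in_unit; move: (clampT t) hs T0 => /andP[? ?].
    by case: (leP 0 (clamp t)) => ? /andP[? ?] ?; apply/andP; split; lra.
  rewrite -[leRHS]mulr1; apply: ler_wpM2l; first by rewrite (le_trans _ (FC i)).
  by apply: le_trans (ltW T1); rewrite ler_norml clampT.
have lim i t := @geometric_limit R (fun k => Y k i t) C (fun k => Y1 k i t).
pose y i t := sval (cid (lim i t)).
have yY k i t : `|Y k i t - y i t| <= 2 * C / 2 ^+ k.
  exact: (svalP (cid (lim i t))).
have cy i : continuous (y i).
  apply: (@geometric_limit_continuous R R (fun k => Y k i) (y i) (2 * C)) => k.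
    exact: yY.
  exact: continuous_Y.
have fix_y i t : y i t = step y i t.
  apply/eqP; rewrite -subr_eq0 -normr_le0; apply: (@le0_geometric _ _ (2 * C)) => k.
  have h1 := yY k.+1 i t.
  have h2 := step_dist (@continuous_Y k) cy (yY k) i t.
  rewrite (_ : y i t - _ = (Y k.+1 i t - step y i t) - (Y k.+1 i t - y i t)); last by ring.
  apply: le_trans (ler_normB _ _) _; apply: le_trans (lerD h2 h1) _.
  rewrite exprSr invfM mulrA -mulrDl.
  by rewrite le_eqVlt; apply/orP; left; apply/eqP; field; rewrite expf_neq0.
exists T => //; exists y; split.
  by move=> i; rewrite fix_y /step clampTE ?normr0 // primitive0 addr0.
move=> t tT i.
have N : \forall s \near t, y0 i + primitive (fun s => F (fun j => y j s) i) s = y i s.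
  have : \forall s \near t, `|s| < T.
    have Tt : 0 < T - `|t| by rewrite subr_gt0.
    apply: filterS (nbhsx_ballx t _ Tt) => s; rewrite /ball /= distrC => ts.
    by have := ler_distD t s 0; rewrite !subr0; lra.
  by apply: filterS => s sT; rewrite fix_y /step clampTE.
apply: near_eq_is_derive N _.
apply: is_derive_eq.
  apply: is_deriveD.
  apply: is_derive_primitive; first exact: continuous_field.
  by apply: in_unit; move: tT; rewrite ltr_norml => /andP[? ?]; rewrite !ltW.
by rewrite add0r.
Qed.

End Picard.

(** A Lipschitz constant may be enlarged, so assuming it at least 1 is no loss. *)
Lemma Picard_Lindelof (R : realType) (I : finType) (F : (I -> R) -> I -> R) (L : R)
    (y0 : I -> R) :
  (forall u w d, (forall j, `|u j - w j| <= d) ->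
    forall i, `|F u i - F w i| <= L * d) ->
  exists2 e : R, 0 < e & exists y : I -> R -> R, (forall i, y i 0 = y0 i) /\
    forall t : R, `|t| < e -> forall i, is_derive t 1 (y i) (F (fun j => y j t) i).
Proof.
move=> lipF; apply: (@Picard_Lindelof_ge1 R I F (Num.max 1 L)).
  by rewrite le_max lexx.
move=> u w d uw i; apply: le_trans (lipF u w d uw i) _.
by apply: ler_wpM2r; [exact: le_trans (uw i)|rewrite le_max lexx orbT].
Qed.

(** * Calculus in charts *)

Section ChartCalculus.
Variables (R : realType) (n : nat) (M : manifold R n).
Implicit Types (c : chart M) (p q : M) (W : set M) (f g : M -> R).

(** Open sets smaller than the chart domain are allowed because computations with two charts live on
    the overlap of their domains. *)
Definition chart_nbh c W := open W /\ W `<=` cdom c.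

Definition chart_smooth c W f := smooth_on (cmap c @` W) (f \o cinv c).

Lemma eq_pd c k f g p : f =1 g -> pd c k f p = pd c k g p.
Proof. by move=> /funext ->. Qed.

Lemma chart_nbh_cdom c : chart_nbh c (cdom c).
Proof. by split=> //; exact: cdom_open. Qed.

Lemma chart_nbhI c W V : chart_nbh c W -> open V -> chart_nbh c (W `&` V).
Proof. by move=> [oW Wc] oV; split; [exact: openI|move=> p [/Wc]]. Qed.

Lemma open_cmap_image c W : chart_nbh c W -> open (cmap c @` W).
Proof.
move=> [oW Wc]; rewrite openE => u [p Wp <-{u}].
have Up : (cmap c @` cdom c) (cmap c p) by exists p => //; exact: Wc.
have N1 : nbhs (cmap c p) (cmap c @` cdom c).
  by apply: open_nbhs_nbhs; split=> //; exact: cimg_open.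
have N2 : nbhs (cmap c p) (cinv c @^-1` W).
  apply: (cinv_continuous Up); rewrite cmapK; last exact: Wc.
  exact: open_nbhs_nbhs.
apply: filterS2 N1 N2 => w [q cq <-] /=; rewrite cmapK // => Wq.
by exists q.
Qed.

Lemma cmap_image c W p : W p -> (cmap c @` W) (cmap c p).
Proof. by exists p. Qed.
Hint Resolve cmap_image : core.

Section Fixed.
Variables (c : chart M) (W : set M).
Hypothesis cW : chart_nbh c W.

Let oW := open_cmap_image cW.

Lemma cinv_image u : (cmap c @` W) u -> W (cinv c u) /\ cmap c (cinv c u) = u.
Proof. by move=> [p Wp <-]; rewrite cmapK //; exact: cW.2. Qed.

Lemma chart_smooth_ext f g : (forall q, W q -> f q = g q) ->
  chart_smooth c W f -> chart_smooth c W g.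
Proof.
move=> fg sf k; apply: Ck_ext (sf k) => // u /cinv_image[Wu _]; exact: fg.
Qed.

Lemma pd_ext k f g p : (forall q, W q -> f q = g q) -> W p ->
  pd c k f p = pd c k g p.
Proof.
move=> fg Wp; apply: near_eq_derive; apply: (near_open oW (cmap_image c Wp)) => u.
by move=> /cinv_image[Wu _]; exact: fg.
Qed.

Lemma chart_smooth_cst (a : R) : chart_smooth c W (cst a).
Proof. by move=> k; exact: Ck_cst. Qed.

Lemma chart_smoothD f g : chart_smooth c W f -> chart_smooth c W g ->
  chart_smooth c W (f \+ g).
Proof. by move=> sf sg k; exact: (CkD oW (sf k) (sg k)). Qed.

Lemma chart_smoothM f g : chart_smooth c W f -> chart_smooth c W g ->
  chart_smooth c W (f \* g).
Proof. by move=> sf sg k; exact: (CkM oW (sf k) (sg k)). Qed.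

Lemma chart_smooth_sum (I : Type) (r : seq I) (P : pred I) (F : I -> M -> R) :
  (forall i, chart_smooth c W (F i)) ->
  chart_smooth c W (fun q => \sum_(i <- r | P i) F i q).
Proof. by move=> sF k; exact: (Ck_sum r P oW (fun i => sF i k)). Qed.

Lemma chart_smooth_prod (I : Type) (r : seq I) (P : pred I) (F : I -> M -> R) :
  (forall i, chart_smooth c W (F i)) ->
  chart_smooth c W (fun q => \prod_(i <- r | P i) F i q).
Proof. by move=> sF k; exact: (Ck_prod r P oW (fun i => sF i k)). Qed.

Lemma chart_smoothZ (a : R) f : chart_smooth c W f ->
  chart_smooth c W (fun q => a * f q).
Proof. by move=> sf; apply: (chart_smoothM (chart_smooth_cst a) sf). Qed.

Lemma chart_smoothN f : chart_smooth c W f -> chart_smooth c W (fun q => - f q).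
Proof.
by move=> sf; apply: chart_smooth_ext (chart_smoothZ (-1) sf) => q _; rewrite mulN1r.
Qed.

Lemma chart_smoothV f : (forall q, W q -> f q != 0) -> chart_smooth c W f ->
  chart_smooth c W (fun q => (f q)^-1).
Proof.
move=> f0 sf k; apply: (CkV oW _ (sf k)) => u /cinv_image[Wu _]; exact: f0.
Qed.

Lemma chart_smooth_pd k f : chart_smooth c W f -> chart_smooth c W (pd c k f).
Proof.
move=> sf m; apply: Ck_ext (smooth_derive k sf m) => // u /cinv_image[_ uE].
by rewrite /= /pd uE.
Qed.

Lemma pd_cst k (a : R) p : pd c k (cst a) p = 0.
Proof. exact: derive_cst. Qed.

Lemma pd_derivable k f p : chart_smooth c W f -> W p ->
  derivable (f \o cinv c) (cmap c p) 'e_k.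
Proof. by move=> sf Wp; apply: smooth_derivable sf _; exists p. Qed.

Lemma pdD k f g p : chart_smooth c W f -> chart_smooth c W g -> W p ->
  pd c k (f \+ g) p = pd c k f p + pd c k g p.
Proof. by move=> sf sg Wp; apply: deriveD; exact: pd_derivable. Qed.

Lemma pdM k f g p : chart_smooth c W f -> chart_smooth c W g -> W p ->
  pd c k (f \* g) p = pd c k f p * g p + f p * pd c k g p.
Proof.
move=> sf sg Wp; have e : cinv c (cmap c p) = p by rewrite cmapK //; exact: cW.2.
rewrite /pd (_ : (f \* g) \o cinv c = (f \o cinv c) * (g \o cinv c)) //.
rewrite deriveM; try exact: pd_derivable.
by rewrite /GRing.scale /= e addrC [in X in X + _]mulrC.
Qed.

Lemma pdZ k (a : R) f p : chart_smooth c W f -> W p ->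
  pd c k (fun q => a * f q) p = a * pd c k f p.
Proof.
move=> sf Wp; have := pdM k (chart_smooth_cst a) sf Wp.
by rewrite pd_cst mul0r add0r.
Qed.

Lemma pd_sum k (I : Type) (r : seq I) (P : pred I) (F : I -> M -> R) p :
  (forall i, chart_smooth c W (F i)) -> W p ->
  pd c k (fun q => \sum_(i <- r | P i) F i q) p = \sum_(i <- r | P i) pd c k (F i) p.
Proof.
move=> sF Wp; elim: r => [|i r IH].
  rewrite big_nil -[RHS](pd_cst k 0 p); apply: eq_pd => q.
  by rewrite big_nil.
rewrite big_cons -IH; case: (boolP (P i)) => Pi.
  rewrite -pdD //; last exact: chart_smooth_sum.
  by apply: eq_pd => q; rewrite big_cons Pi.
by apply: eq_pd => q; rewrite big_cons (negbTE Pi).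
Qed.

Lemma pdC k l f p : chart_smooth c W f -> W p ->
  pd c k (pd c l f) p = pd c l (pd c k f) p.
Proof.
move=> sf Wp.
have E i j : pd c i (pd c j f) p = 'D_'e_i ('D_'e_j (f \o cinv c)) (cmap c p).
  apply: near_eq_derive; apply: (near_open oW (cmap_image c Wp)) => u.
  by move=> /cinv_image[_ uE]; rewrite /= /pd uE.
by rewrite !E; apply: Schwarz oW (sf 2%N) _; exists p.
Qed.

End Fixed.

Lemma chart_smooth_sub c W V f : V `<=` W -> chart_smooth c W f -> chart_smooth c V f.
Proof. by move=> VW sf k; apply: Ck_subset (sf k); exact: image_subset. Qed.

Section Change.
Variables (c c' : chart M) (W : set M).
Hypotheses (cW : chart_nbh c W) (cW' : chart_nbh c' W).

Let T u := cmap c' (cinv c u).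

Lemma chart_smooth_coord i : chart_smooth c W (fun q => cmap c' q ord0 i).
Proof.
apply: (@chart_smooth_sub _ (cdom c `&` cdom c')).
  by move=> q Wq; split; [exact: cW.2|exact: cW'.2].
by move=> k; exact: chart_compatible.
Qed.

Let T_image u : (cmap c @` W) u -> (cmap c' @` W) (T u).
Proof. by move=> /(cinv_image cW)[Wu _]; exists (cinv c u). Qed.

Let transition f u : (cmap c @` W) u ->
  ((f \o cinv c') \o T) u = (f \o cinv c) u.
Proof.
move=> /(cinv_image cW)[Wu _]; rewrite /= /T cmapK //; exact: cW'.2.
Qed.

Lemma chart_smooth_change f : chart_smooth c' W f -> chart_smooth c W f.
Proof.
move=> sf k; apply: Ck_ext (open_cmap_image cW) (@transition f) _.
apply: (smooth_comp (open_cmap_image cW') (open_cmap_image cW) _ T_image sf).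
exact: chart_smooth_coord.
Qed.

Lemma pd_change k f p : chart_smooth c' W f -> W p ->
  pd c k f p = \sum_a pd c' a f p * jac c c' p a k.
Proof.
move=> sf Wp; have Up := cmap_image c Wp.
rewrite /pd -(@near_eq_derive _ _ _ ((f \o cinv c') \o T)); last first.
  exact: (near_open (open_cmap_image cW) Up (@transition f)).
have Tp : T (cmap c p) = cmap c' p by rewrite /T cmapK //; exact: cW.2.
have [] := @derive_compE R n _ T (f \o cinv c') (cmap c p) 'e_k.
- apply: smooth_differentiable (open_cmap_image cW') sf _.
  by rewrite Tp; exact: cmap_image.
- exact: smooth_coords_derivable (fun a => chart_smooth_coord a) Up.
by move=> _ ->; rewrite Tp; apply: eq_bigr => a _; rewrite mxE.
Qed.

End Change.
End ChartCalculus.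

(** * Matrix-valued functions and Jacobians *)

Section MatrixCalculus.
Variables (R : realType) (n : nat) (M : manifold R n).
Implicit Types (c : chart M) (p q : M) (W : set M).

Definition smooth_mx c W a b (F : M -> 'M[R]_(a, b)) :=
  forall i j, chart_smooth c W (fun q => F q i j).

Definition dmx_def c (k : 'I_n) a b (F : M -> 'M[R]_(a, b)) p : 'M[R]_(a, b) :=
  \matrix_(i, j) pd c k (fun q => F q i j) p.

(* Locked: unifying two unfolded iterated derivatives is prohibitively slow. *)
Definition dmx := locked dmx_def.
Arguments dmx c k {a b} F p.

Lemma dmxE c k a b (F : M -> 'M[R]_(a, b)) p i j :
  dmx c k F p i j = pd c k (fun q => F q i j) p.
Proof. by rewrite /dmx -lock mxE. Qed.

Section Fixed.
Variables (c : chart M) (W : set M).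
Hypothesis cW : chart_nbh c W.

Lemma dmx_ext k a b (F G : M -> 'M[R]_(a, b)) p :
  (forall q, W q -> F q = G q) -> W p -> dmx c k F p = dmx c k G p.
Proof.
by move=> FG Wp; apply/matrixP => i j; rewrite !dmxE; apply: (pd_ext cW) => // q /FG ->.
Qed.

Lemma smooth_mxM a b d (F : M -> 'M[R]_(a, b)) (G : M -> 'M[R]_(b, d)) :
  smooth_mx c W F -> smooth_mx c W G -> smooth_mx c W (fun q => F q *m G q).
Proof.
move=> sF sG i j.
apply: (@chart_smooth_ext _ _ _ _ _ cW (fun q => \sum_m F q i m * G q m j)).
  by move=> q _; rewrite mxE.
by apply: chart_smooth_sum => // m; apply: chart_smoothM.
Qed.

Lemma dmxM k a b d (F : M -> 'M[R]_(a, b)) (G : M -> 'M[R]_(b, d)) p :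
  smooth_mx c W F -> smooth_mx c W G -> W p ->
  dmx c k (fun q => F q *m G q) p = dmx c k F p *m G p + F p *m dmx c k G p.
Proof.
move=> sF sG Wp; apply/matrixP => i j; rewrite dmxE [RHS]mxE.
rewrite [X in _ = X + _]mxE [X in _ = _ + X]mxE -big_split /=.
have -> : (fun q => (F q *m G q) i j) = (fun q => \sum_m F q i m * G q m j).
  by apply: funext => q; rewrite mxE.
rewrite (pd_sum cW) //; last by move=> m; apply: chart_smoothM.
by apply: eq_bigr => m _; rewrite !dmxE; apply: (pdM cW).
Qed.

Lemma dmxD k a b (F G : M -> 'M[R]_(a, b)) p :
  smooth_mx c W F -> smooth_mx c W G -> W p ->
  dmx c k (fun q => F q + G q) p = dmx c k F p + dmx c k G p.
Proof.
move=> sF sG Wp; apply/matrixP => i j; rewrite dmxE [RHS]mxE !dmxE -(pdD (W := W)) //.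
by apply: eq_pd => q; rewrite mxE.
Qed.

Lemma smooth_mxT a b (F : M -> 'M[R]_(a, b)) :
  smooth_mx c W F -> smooth_mx c W (fun q => (F q)^T).
Proof.
by move=> sF i j; apply: chart_smooth_ext (sF j i) => // q _; rewrite mxE.
Qed.

Lemma dmxT k a b (F : M -> 'M[R]_(a, b)) p :
  dmx c k (fun q => (F q)^T) p = (dmx c k F p)^T.
Proof.
apply/matrixP => i j; rewrite [RHS]mxE !dmxE; apply: eq_pd => q.
by rewrite mxE.
Qed.

Lemma smooth_mxZ a b (f : M -> R) (F : M -> 'M[R]_(a, b)) :
  chart_smooth c W f -> smooth_mx c W F -> smooth_mx c W (fun q => f q *: F q).
Proof.
move=> sf sF i j; apply: chart_smooth_ext (chart_smoothM cW sf (sF i j)) => //.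
by move=> q _; rewrite mxE.
Qed.

Lemma dmxZ k a b (f : M -> R) (F : M -> 'M[R]_(a, b)) p :
  chart_smooth c W f -> smooth_mx c W F -> W p ->
  dmx c k (fun q => f q *: F q) p = pd c k f p *: F p + f p *: dmx c k F p.
Proof.
move=> sf sF Wp; apply/matrixP => i j; rewrite dmxE !mxE dmxE -(pdM cW) //.
by apply: eq_pd => q; rewrite mxE.
Qed.

Lemma smooth_mx_sum (I : Type) (r : seq I) (P : pred I) a b
    (F : I -> M -> 'M[R]_(a, b)) :
  (forall m, smooth_mx c W (F m)) ->
  smooth_mx c W (fun q => \sum_(m <- r | P m) F m q).
Proof.
move=> sF i j.
apply: (@chart_smooth_ext _ _ _ _ _ cW (fun q => \sum_(m <- r | P m) F m q i j)).
  by move=> q _; rewrite summxE.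
by apply: chart_smooth_sum => // m; exact: sF.
Qed.

Lemma dmx_sum k (I : Type) (r : seq I) (P : pred I) a b
    (F : I -> M -> 'M[R]_(a, b)) p :
  (forall m, smooth_mx c W (F m)) -> W p ->
  dmx c k (fun q => \sum_(m <- r | P m) F m q) p = \sum_(m <- r | P m) dmx c k (F m) p.
Proof.
move=> sF Wp; apply/matrixP => i j; rewrite dmxE summxE.
rewrite (_ : (fun q => _) = (fun q => \sum_(m <- r | P m) F m q i j)); last first.
  by apply: funext => q; rewrite summxE.
rewrite (pd_sum cW) //; last by move=> m; exact: sF.
by apply: eq_bigr => m _; rewrite dmxE.
Qed.

Lemma smooth_mx_dmx k a b (F : M -> 'M[R]_(a, b)) :
  smooth_mx c W F -> smooth_mx c W (dmx c k F).
Proof.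
move=> sF i j; apply: chart_smooth_ext (chart_smooth_pd cW k (sF i j)) => //.
by move=> q _; rewrite dmxE.
Qed.

Lemma dmxC k l a b (F : M -> 'M[R]_(a, b)) p : smooth_mx c W F -> W p ->
  dmx c k (dmx c l F) p = dmx c l (dmx c k F) p.
Proof.
move=> sF Wp; apply/matrixP => i j; rewrite 2!dmxE.
rewrite (eq_pd c k p (fun q => dmxE c l F q i j)).
rewrite (eq_pd c l p (fun q => dmxE c k F q i j)).
exact: (pdC cW k l (sF i j) Wp).
Qed.

Lemma smooth_det m (F : M -> 'M[R]_m) :
  smooth_mx c W F -> chart_smooth c W (fun q => \det (F q)).
Proof.
move=> sF; apply: (chart_smooth_sum cW) => s.
apply: (chart_smoothZ cW); exact: (chart_smooth_prod cW).
Qed.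

(** Cramer's rule: the entries are cofactors divided by the determinant. *)
Lemma smooth_invmx m (F : M -> 'M[R]_m) : (forall q, W q -> F q \in unitmx) ->
  smooth_mx c W F -> smooth_mx c W (fun q => invmx (F q)).
Proof.
move=> uF sF i j.
apply: (@chart_smooth_ext _ _ _ _ _ cW
  ((fun q => (\det (F q))^-1) \* (fun q => \adj (F q) i j))).
  by move=> q Wq; rewrite /= /invmx uF // [RHS]mxE.
apply: (chart_smoothM cW).
  apply: (chart_smoothV cW); last exact: smooth_det.
  by move=> q /uF; rewrite unitmxE unitfE.
apply: (@chart_smooth_ext _ _ _ _ _ cW
  (fun q => (-1) ^+ (j + i) * \det (row' j (col' i (F q))))).
  by move=> q _; rewrite mxE.
apply: (chart_smoothZ cW); apply: smooth_det => a b.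
by apply: chart_smooth_ext (sF (lift j a) (lift i b)) => // q _; rewrite !mxE.
Qed.

End Fixed.

Lemma dmx_change c c' W k a b (F : M -> 'M[R]_(a, b)) p :
  chart_nbh c W -> chart_nbh c' W -> smooth_mx c' W F -> W p ->
  dmx c k F p = \sum_m jac c c' p m k *: dmx c' m F p.
Proof.
move=> cW cW' sF Wp; apply/matrixP => i j; rewrite dmxE summxE (pd_change cW cW') //.
by apply: eq_bigr => m _; rewrite [RHS]mxE dmxE mulrC.
Qed.

Lemma smooth_mx_change c c' W a b (F : M -> 'M[R]_(a, b)) :
  chart_nbh c W -> chart_nbh c' W -> smooth_mx c' W F -> smooth_mx c W F.
Proof. by move=> cW cW' sF i j; apply: (chart_smooth_change cW cW'); exact: sF. Qed.

Lemma smooth_jac c c' W : chart_nbh c W -> chart_nbh c' W ->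
  smooth_mx c W (jac c c').
Proof.
move=> cW cW' i j.
apply: chart_smooth_ext (chart_smooth_pd cW j (chart_smooth_coord cW cW' i)) => //.
by move=> q _; rewrite mxE.
Qed.

Lemma pd_coord c W p i j : chart_nbh c W -> W p ->
  pd c j (fun q => cmap c q ord0 i) p = (i == j)%:R.
Proof.
move=> cW Wp.
transitivity ('D_'e_j (fun u : 'rV[R]_n => u ord0 i) (cmap c p)).
  apply: near_eq_derive; apply: (near_open (open_cmap_image cW) (cmap_image c Wp)) => u.
  by move=> /(cinv_image cW)[_ uE]; rewrite /= uE.
have := @derive_mx R 'rV[R]_n 1 n id (cmap c p) 'e_j (@derivable_id R _ _ _).
by rewrite derive_id => /matrixP/(_ ord0 i); rewrite !mxE eqxx /= => ->.
Qed.

Lemma jac_id c p : cdom c p -> jac c c p = 1%:M.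
Proof.
move=> cp; apply/matrixP => i j; rewrite !mxE.
exact: pd_coord (chart_nbh_cdom c) cp.
Qed.

(** The chain rule [pd_change], applied to the coordinate functions of c themselves, whose partial
    derivatives in c are Kronecker deltas. *)
Lemma jacK c c' W p : chart_nbh c W -> chart_nbh c' W -> W p ->
  jac c' c p *m jac c c' p = 1%:M.
Proof.
move=> cW cW' Wp; apply/matrixP => i j; rewrite !mxE -(pd_coord i j cW Wp).
rewrite (pd_change cW cW' j (chart_smooth_coord cW' cW i) Wp).
by apply: eq_bigr => a _; rewrite mxE.
Qed.

End MatrixCalculus.

(** * The Levi-Civita connection and its curvature *)

Section LeviCivita.
Variables (R : realType) (n : nat) (M : manifold R n).
Implicit Types (c : chart M) (p q : M) (g : metric M).

Definition christoffel_mx_def g c k p : 'M[R]_n :=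
  \matrix_(i, j) christoffel g c i k j p.

(* The k-th connection matrix Gamma^i_{kj}; locked for the same reason as [dmx]. *)
Definition christoffel_mx := locked christoffel_mx_def.
Local Notation Gam := christoffel_mx.

Lemma christoffel_mxE g c k p i j : Gam g c k p i j = christoffel g c i k j p.
Proof. by rewrite /christoffel_mx -lock mxE. Qed.

(** The endomorphism-valued curvature form of the connection; by [curvatureE] its entry (i, j) is
    R^i_{jkl}. *)
Definition curvature_mx_def g c k l p : 'M[R]_n :=
  dmx c k (Gam g c l) p - dmx c l (Gam g c k) p
  + (Gam g c k p *m Gam g c l p - Gam g c l p *m Gam g c k p).

Definition curvature_mx := locked curvature_mx_def.
Local Notation Riem := curvature_mx.

Lemma curvature_mx_unfold g c k l p : Riem g c k l p =
  dmx c k (Gam g c l) p - dmx c l (Gam g c k) p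
  + (Gam g c k p *m Gam g c l p - Gam g c l p *m Gam g c k p).
Proof. by rewrite /curvature_mx -lock. Qed.

Lemma curvature_mxE g c k l p i j : Riem g c k l p i j =
  dmx c k (Gam g c l) p i j - dmx c l (Gam g c k) p i j
  + (\sum_m Gam g c k p i m * Gam g c l p m j
     - \sum_m Gam g c l p i m * Gam g c k p m j).
Proof.
rewrite curvature_mx_unfold.
by move: (dmx _ _ _ _) (dmx _ _ _ _) (Gam _ _ _ _) (Gam _ _ _ _) => A B C D; rewrite !mxE.
Qed.

Section Fixed.
Variables (g : metric M) (c : chart M).

Let cc := chart_nbh_cdom c.

Lemma smooth_metric : smooth_mx c (cdom c) (g c).
Proof. by move=> i j k; exact: metric_smooth. Qed.

Lemma dmx_metric_sym k p : cdom c p -> (dmx c k (g c) p)^T = dmx c k (g c) p.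
Proof.
move=> cp; rewrite -dmxT; apply: (dmx_ext cc) => // q cq; exact: Defs.metric_sym.
Qed.

Lemma smooth_christoffel k : smooth_mx c (cdom c) (Gam g c k).
Proof.
move=> i j.
apply: (@chart_smooth_ext _ _ _ _ _ cc (fun q => 2^-1 * \sum_(l < n)
  (invmx (g c q) i l * (dmx c k (g c) q l j + dmx c j (g c) q l k
    + - dmx c l (g c) q k j)))).
  move=> q _; rewrite christoffel_mxE; congr (_ * _); apply: eq_bigr => l _.
  by rewrite !dmxE.
have sd a := smooth_mx_dmx cc a smooth_metric.
apply: (chart_smoothZ cc); apply: (chart_smooth_sum cc) => l.
apply: (chart_smoothM cc).
  apply: (smooth_invmx cc) => [q cq|]; last exact: smooth_metric.
  exact: metric_nondegenerate.
apply: (chart_smoothD cc); first by apply: (chart_smoothD cc); exact: sd.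
by apply: (chart_smoothN cc); exact: sd.
Qed.

Section Point.
Variable p : M.
Hypothesis cp : cdom c p.

Lemma lower_christoffel k i j : (g c p *m Gam g c k p) i j =
  2^-1 * (dmx c k (g c) p i j + dmx c j (g c) p i k - dmx c i (g c) p k j).
Proof.
have -> : Gam g c k p = invmx (g c p) *m
    \matrix_(l, m) (2^-1 * (dmx c k (g c) p l m + dmx c m (g c) p l k
      - dmx c l (g c) p k m)).
  apply/matrixP => a b; rewrite christoffel_mxE mxE /christoffel mulr_sumr.
  by apply: eq_bigr => l _; rewrite mxE !dmxE mulrCA.
by rewrite mulmxA mulmxV ?metric_nondegenerate // mul1mx mxE.
Qed.

Lemma christoffel_sym k i j : Gam g c k p i j = Gam g c j p i k.
Proof.
rewrite !christoffel_mxE /christoffel; congr (_ * _); apply: eq_bigr => l _.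
congr (_ * _); rewrite [X in X - _]addrC; congr (_ - _).
by rewrite -!(dmxE c l (g c)) -[in RHS]dmx_metric_sym // mxE.
Qed.

(** This is nabla g = 0, in the matrix form that characterises the connection in
    [Levi_Civita_unique] and is differentiated in [curvature_antisym]. *)
Lemma christoffel_metric k :
  g c p *m Gam g c k p + (g c p *m Gam g c k p)^T = dmx c k (g c) p.
Proof.
apply/matrixP => i j; rewrite mxE [X in _ + X]mxE !lower_christoffel.
have S a i' j' : dmx c a (g c) p i' j' = dmx c a (g c) p j' i'.
  by rewrite -[in RHS]dmx_metric_sym // mxE.
by rewrite (S k j i) (S i j k) (S j i k); field.
Qed.

(** Koszul's argument: when metric compatibility is inserted into the three derivatives of g in
    [lower_christoffel], torsion-freeness cancels everything except 2 (g A_k)_{ij}. *)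
Lemma Levi_Civita_unique (A : 'I_n -> 'M[R]_n) :
  (forall k i j, A k i j = A j i k) ->
  (forall k, g c p *m A k + (g c p *m A k)^T = dmx c k (g c) p) ->
  forall k, A k = Gam g c k p.
Proof.
move=> symA metA k.
rewrite -[LHS]mul1mx -[RHS]mul1mx -(mulVmx (metric_nondegenerate g cp)).
rewrite -!mulmxA; congr (_ *m _); apply/matrixP => i j.
rewrite lower_christoffel.
have m a b d : dmx c a (g c) p b d = (g c p *m A a) b d + (g c p *m A a) d b.
  by rewrite -metA mxE [X in _ + X]mxE.
have s a b d : (g c p *m A a) b d = (g c p *m A d) b a.
  by rewrite !mxE; apply: eq_bigr => l _; rewrite symA.
rewrite !m (s j i k) (s k j i) (s j k i); by field.
Qed.

End Point.

Section Curvature.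
Variable p : M.
Hypothesis cp : cdom c p.

Lemma curvatureE i j k l : riemann g c i j k l p = Riem g c k l p i j.
Proof.
pose V := fun (i' : 'I_n) (_ : M) => (i' == j)%:R : R.
have EV : nabla_vec g c V = (fun l' i' q => Gam g c l' q i' j).
  apply: funext => l'; apply: funext => i'; apply: funext => q.
  rewrite /nabla_vec pd_cst add0r christoffel_mxE (bigD1 j) //= /V eqxx mulr1.
  by rewrite big1 ?addr0 // => m /negbTE ->; rewrite mulr0.
rewrite /riemann /nabla2_vec -/V EV /nabla_11 -!dmxE curvature_mxE.
have D a b : \sum_(m < n) christoffel g c i a m p * Gam g c b p m j =
    \sum_m Gam g c a p i m * Gam g c b p m j.
  by apply: eq_bigr => m _; rewrite (christoffel_mxE g c a).
rewrite (D k l) (D l k).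
(* The correction for the derivative index of [nabla_vec V] is symmetric in k and l, so it drops out
   of the commutator. *)
have -> : \sum_(m < n) christoffel g c m k l p * Gam g c m p i j =
          \sum_(m < n) christoffel g c m l k p * Gam g c m p i j.
  by apply: eq_bigr => m _; rewrite -!christoffel_mxE (christoffel_sym cp).
by rewrite opprB addrA subrK addrACA opprD.
Qed.

(* Symmetry of second derivatives, applied to dG = G Gamma + (G Gamma)^T. *)
Lemma curvature_antisym k l :
  g c p *m Riem g c k l p + (g c p *m Riem g c k l p)^T = 0.
Proof.
have dd a b : dmx c a (dmx c b (g c)) p =
    dmx c a (g c) p *m Gam g c b p + g c p *m dmx c a (Gam g c b) p +
    (dmx c a (g c) p *m Gam g c b p + g c p *m dmx c a (Gam g c b) p)^T.
  have sm := smooth_mxM cc smooth_metric (smooth_christoffel b).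
  rewrite -(dmxM cc a smooth_metric (smooth_christoffel b) cp) -dmxT.
  rewrite -(dmxD a sm (smooth_mxT cc sm) cp).
  by apply: (dmx_ext cc) => // q cq; rewrite (christoffel_metric cq).
have := dd k l; rewrite (dmxC cc k l smooth_metric cp) (dd l k).
rewrite -!(christoffel_metric cp) curvature_mx_unfold.
move: (dmx c k (Gam g c l) p) (dmx c l (Gam g c k) p) => dA dB.
have : (g c p)^T = g c p by exact: Defs.metric_sym.
move: (Gam g c k p) (Gam g c l p) (g c p) => A B G GT.
(* Exchanging k and l turns P into Q and S into its transpose; after symmetrisation the mixed terms
   are equal, leaving P + P^T = Q + Q^T. *)
pose P := G *m A *m B + G *m dA; pose Q := G *m B *m A + G *m dB.
pose S := (G *m A)^T *m B.
have -> : (G *m A + (G *m A)^T) *m B + G *m dA = P + S.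
  by rewrite mulmxDl addrAC.
have -> : (G *m B + (G *m B)^T) *m A + G *m dB = Q + S^T.
  by rewrite mulmxDl addrAC /S !trmx_mul !trmxK GT !mulmxA.
have -> : G *m (dA - dB + (A *m B - B *m A)) = P - Q.
  rewrite mulmxDr !mulmxBr !mulmxA /P /Q.
  move: (_ *m B) (_ *m A) (_ *m dA) (_ *m dB) => X Y Z W.
  by apply/matrixP => i j; rewrite !mxE; ring.
move: P Q S => P Q S /matrixP E; apply/matrixP => i j; have := E i j.
by rewrite !mxE; lra.
Qed.

Lemma Bianchi i j k l :
  Riem g c k l p i j + Riem g c l j p i k + Riem g c j k p i l = 0.
Proof.
have S b a i' j' : dmx c b (Gam g c a) p i' j' = dmx c b (Gam g c j') p i' a.
  rewrite !dmxE; apply: (pd_ext cc) => // q cq.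
  exact: christoffel_sym.
rewrite !curvature_mxE (S k l i j) (S l j i k) (S j k i l).
have P a b d : \sum_m Gam g c a p i m * Gam g c b p m d =
               \sum_m Gam g c a p i m * Gam g c d p m b.
  by apply: eq_bigr => m _; rewrite (christoffel_sym cp b).
rewrite (P k l j) (P l j k) (P j k l).
ring.
Qed.

(** By [curvature_antisym] the matrix F of the curvature satisfies g F = - F^T g, so F is conjugate
    to - F^T and its trace equals its own opposite. *)
Lemma trace_curvature k l : \tr (Riem g c k l p) = 0.
Proof.
have := curvature_antisym k l.
have : g c p \in unitmx by exact: metric_nondegenerate.
have : (g c p)^T = g c p by exact: Defs.metric_sym.
move: (Riem _ _ _ _ _) (g c p) => F G GT uG /eqP; rewrite addr_eq0 => /eqP E.
have : \tr F = - \tr F; last by move=> h; lra.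
rewrite -{1}[F]mul1mx -(mulVmx uG) -mulmxA E mulmxN linearN /= mxtrace_mulC.
rewrite trmx_mul GT -mulmxA mulmxV // mulmx1 mxtrace_tr.
by [].
Qed.

Lemma ricciE j l : ricci g c j l p = \sum_a Riem g c a l p a j.
Proof. by apply: eq_bigr => a _; rewrite curvatureE. Qed.

(** By the Bianchi identity the antisymmetric part of Ricci is, up to sign, a trace of the curvature
    endomorphism. That this trace vanishes comes from the metric: torsion-freeness alone does not
    give it. *)
Lemma ricci_sym j l : ricci g c j l p = ricci g c l j p.
Proof.
apply/eqP; rewrite -subr_eq0 !ricciE -sumrB.
rewrite (eq_bigr (fun a => - Riem g c l j p a a)) => [|a _].
  by rewrite sumrN -/(\tr _) trace_curvature oppr0.
have := Bianchi a j a l.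
have -> : Riem g c j a p a l = - Riem g c a j p a l.
  by rewrite !curvature_mxE opprD !opprB.
by move: (Riem _ _ _ _ _ _ _) (Riem _ _ _ _ _ _ _) (Riem _ _ _ _ _ _ _) => x y z h; lra.
Qed.

End Curvature.
End Fixed.
End LeviCivita.

(** The algebra of a gauge transformation J Gamma = B J + dJ: the curvature is conjugated by J. The
    last two hypotheses are the derivatives of the first two; s stands for the second derivative of
    J, which is the same in both orders and cancels. *)
Lemma gauge_curvature (R : comPzRingType) n (J Gk Gl Bk Bl dk dl dGk dGl dBk dBl s : 'M[R]_n) :
  J *m Gk = Bk *m J + dk -> J *m Gl = Bl *m J + dl ->
  dk *m Gl + J *m dGl = dBl *m J + Bl *m dk + s ->
  dl *m Gk + J *m dGk = dBk *m J + Bk *m dl + s ->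
  J *m (dGl - dGk + (Gk *m Gl - Gl *m Gk)) =
  (dBl - dBk + (Bk *m Bl - Bl *m Bk)) *m J.
Proof.
move=> Ek El Dl Dk.
have {}Dl : J *m dGl = dBl *m J + Bl *m dk + s - dk *m Gl.
  by rewrite -Dl addrC addKr.
have {}Dk : J *m dGk = dBk *m J + Bk *m dl + s - dl *m Gk.
  by rewrite -Dk addrC addKr.
rewrite mulmxDr !mulmxBr !mulmxA Ek El Dl Dk !mulmxDl -[Bk *m J *m _]mulmxA.
rewrite -[Bl *m J *m _]mulmxA Ek El !mulmxDr !mulNmx !mulmxA.
move: (dBl *m J) (dBk *m J) (Bl *m dk) (Bk *m dl) (dk *m Gl) (dl *m Gk).
move: (Bk *m Bl *m J) (Bl *m Bk *m J) => a b c d e f h m.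
by apply/matrixP => i j; rewrite !mxE; ring.
Qed.

(** * Change of chart for the connection, the curvature and the Ricci tensor *)

Section ChartChange.
Variables (R : realType) (n : nat) (M : manifold R n) (g : metric M).
Variables (c c' : chart M).
Local Notation Gam := (christoffel_mx g).
Local Notation Riem := (curvature_mx g).

Let W := cdom c `&` cdom c'.

Let cW : chart_nbh c W.
Proof. by apply: chart_nbhI; [exact: chart_nbh_cdom|exact: cdom_open]. Qed.

Let cW' : chart_nbh c' W.
Proof. by rewrite /W setIC; apply: chart_nbhI; [exact: chart_nbh_cdom|exact: cdom_open]. Qed.

Let sJ := smooth_jac cW cW'.

Let sub a b (F : M -> 'M[R]_(a, b)) : smooth_mx c' (cdom c') F -> smooth_mx c' W F.
Proof. by move=> sF i j; apply: chart_smooth_sub (sF i j) => q []. Qed.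

Let subc a b (F : M -> 'M[R]_(a, b)) : smooth_mx c (cdom c) F -> smooth_mx c W F.
Proof. by move=> sF i j; apply: chart_smooth_sub (sF i j) => q []. Qed.

Local Notation J := (jac c c').

(** The pullback of the connection form of c', in the form index alone: the frame is still that of
    c'. *)
Let pulled k q : 'M[R]_n := \sum_m J q m k *: Gam c' m q.

Lemma jac_inv p : W p -> J p *m jac c' c p = 1%:M.
Proof. exact: (jacK cW' cW). Qed.

Lemma jac_invV p : W p -> jac c' c p *m J p = 1%:M.
Proof. exact: (jacK cW cW'). Qed.

Let dJ_sym p k i j : W p -> dmx c k J p i j = dmx c j J p i k.
Proof.
move=> Wp; rewrite !dmxE.
have E b : (fun q => J q i b) = pd c b (fun q => cmap c' q ord0 i).
  by apply: funext => q; rewrite mxE.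
by rewrite !E; apply: (pdC cW); first exact: chart_smooth_coord cW cW' i.
Qed.

(* By uniqueness: the right-hand side transported by J^-1 is a torsion-free
   connection compatible with g = J^T g' J. *)
Lemma christoffel_mx_change p k : W p ->
  J p *m Gam c k p = (\sum_m J p m k *: Gam c' m p) *m J p + dmx c k J p.
Proof.
move=> Wp; have [cp cp'] := Wp.
pose A l := jac c' c p *m (pulled l p *m J p + dmx c l J p).
rewrite -(@Levi_Civita_unique R n M g c p cp A) /A.
- by rewrite mulmxA jac_inv // mul1mx.
- move=> l i j; rewrite !mxE; apply: eq_bigr => a _; congr (_ * _).
  rewrite mxE [RHS]mxE (dJ_sym l a j Wp); congr (_ + _); rewrite !mxE.
  under eq_bigr => b _ do rewrite summxE mulr_suml.
  under [RHS]eq_bigr => b _ do rewrite summxE mulr_suml.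
  rewrite exchange_big /=; apply: eq_bigr => b _; apply: eq_bigr => m _.
  rewrite [X in X * _]mxE [X in _ = X * _]mxE (christoffel_sym g cp').
  by rewrite mulrC mulrA mulrAC.
- move=> l; rewrite (metric_law g cp cp').
  set G' := g c' p; set B := pulled l p; set d := dmx c l J p.
  (* The product rule for J^T g' J, with metric compatibility in the chart c' for the derivative of
     the middle factor. *)
  have dG : dmx c l (g c) p = d^T *m G' *m J p +
      (J p)^T *m (G' *m B + (G' *m B)^T) *m J p + (J p)^T *m G' *m d.
    have sG : smooth_mx c W (g c').
      exact: (smooth_mx_change cW cW' (sub (smooth_metric g c'))).
    have sT := smooth_mxT cW sJ.
    rewrite (@dmx_ext _ _ _ c W cW _ _ _ _ (fun q => (J q)^T *m g c' q *m J q)) //.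
      rewrite (dmxM cW _ (smooth_mxM cW sT sG) sJ) // (dmxM cW _ sT sG) // dmxT.
      rewrite (dmx_change l cW cW' (sub (smooth_metric g c')) Wp).
      rewrite -/G' -/d mulmxDl; congr (_ + _ *m _ *m _ + _).
      rewrite /B /pulled mulmx_sumr linear_sum -big_split /=; apply: eq_bigr => m _.
      by rewrite -(christoffel_metric g cp') -scalemxAr linearZ -scalerDr.
    by move=> q [cq cq']; exact: metric_law.
  rewrite dG !mulmxA -(mulmxA _ (J p) (jac c' c p)) jac_inv // mulmx1.
  have GT : G'^T = G' by exact: Defs.metric_sym.
  pose X := (J p)^T *m G' *m B *m J p; pose Y := (J p)^T *m G' *m d.
  have YT : d^T *m G' *m J p = Y^T by rewrite /Y !trmx_mul trmxK GT mulmxA.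
  have XT : (J p)^T *m (G' *m B)^T *m J p = X^T.
    by rewrite /X !trmx_mul trmxK GT !mulmxA.
  rewrite mulmxDr mulmxA -/X -/Y mulmxDr mulmxDl XT YT mulmxA -/X.
  by move: X Y {XT YT} => X Y; apply/matrixP => i j; rewrite !mxE; ring.
Qed.

Let pulled_smooth k : smooth_mx c W (pulled k).
Proof.
apply: smooth_mx_sum => // m; apply: (smooth_mxZ cW (sJ m k)).
exact: (smooth_mx_change cW cW' (sub (smooth_christoffel g c' m))).
Qed.

(** The exterior derivative commutes with pullback, since the second derivatives of the transition
    map are symmetric and cancel. *)
Let dpulled p k l : W p -> dmx c k (pulled l) p - dmx c l (pulled k) p =
  \sum_a \sum_b (J p a k * J p b l) *: (dmx c' a (Gam c' b) p - dmx c' b (Gam c' a) p).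
Proof.
move=> Wp.
have E k' l' : dmx c k' (pulled l') p =
    \sum_b dmx c k' J p b l' *: Gam c' b p +
    \sum_a \sum_b (J p a k' * J p b l') *: dmx c' a (Gam c' b) p.
  have sG b : smooth_mx c' W (Gam c' b) by exact: sub (smooth_christoffel g c' b).
  have sG' b : smooth_mx c W (Gam c' b) by exact: smooth_mx_change cW cW' (sG b).
  rewrite (dmx_sum cW) //; last first.
    by move=> m; apply: (smooth_mxZ cW (sJ m l')).
  rewrite exchange_big /= -big_split /=; apply: eq_bigr => b _.
  rewrite (dmxZ cW k' (sJ b l') (sG' b) Wp).
  rewrite dmxE; congr (_ + _).
  rewrite (dmx_change k' cW cW' (sG b) Wp) scaler_sumr; apply: eq_bigr => a _.
  by rewrite scalerA mulrC.
rewrite !E opprD addrACA (eq_bigr (fun b => dmx c l J p b k *: Gam c' b p)); last first.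
  by move=> b _; rewrite (dJ_sym k b l Wp).
rewrite subrr add0r [X in _ - X]exchange_big /= -sumrB; apply: eq_bigr => a _.
rewrite -sumrB; apply: eq_bigr => b _.
by rewrite scalerBr [J p b l * _]mulrC.
Qed.

(** The curvature of [pulled] is the pullback of the curvature in c'; [gauge_curvature] then changes
    the frame by J. *)
Lemma curvature_mx_change p k l : W p -> J p *m Riem c k l p =
  (\sum_a \sum_b (J p a k * J p b l) *: Riem c' a b p) *m J p.
Proof.
move=> Wp.
have -> : \sum_a \sum_b (J p a k * J p b l) *: Riem c' a b p =
    (dmx c k (pulled l) p - dmx c l (pulled k) p) +
    (pulled k p *m pulled l p - pulled l p *m pulled k p).
  have PP i j : pulled i p *m pulled j p =
      \sum_a \sum_b (J p a i * J p b j) *: (Gam c' a p *m Gam c' b p).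
    rewrite /pulled mulmx_suml; apply: eq_bigr => a _; rewrite mulmx_sumr.
    by apply: eq_bigr => b _; rewrite -scalemxAl -scalemxAr scalerA.
  rewrite (dpulled k l Wp) (PP k l) (PP l k) [X in _ + (_ - X)]exchange_big /=.
  rewrite -sumrB -big_split /=; apply: eq_bigr => a _.
  rewrite -sumrB -big_split /=; apply: eq_bigr => b _.
  by rewrite [J p b l * _]mulrC -scalerBr -scalerDr curvature_mx_unfold.
have L q j : W q -> J q *m Gam c j q = pulled j q *m J q + dmx c j J q.
  exact: christoffel_mx_change.
have D i j : dmx c i J p *m Gam c j p + J p *m dmx c i (Gam c j) p =
    dmx c i (pulled j) p *m J p + pulled j p *m dmx c i J p + dmx c i (dmx c j J) p.
  have sG := subc (smooth_christoffel g c j).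
  rewrite -(dmxM cW i sJ sG Wp) -(dmxM cW i (pulled_smooth j) sJ Wp).
  rewrite -(dmxD i (smooth_mxM cW (pulled_smooth j) sJ) (smooth_mx_dmx cW j sJ) Wp).
  by apply: (dmx_ext cW) => // q Wq; exact: L.
rewrite curvature_mx_unfold; have Dlk := D l k; rewrite (dmxC cW l k sJ Wp) in Dlk.
exact: gauge_curvature (L p k Wp) (L p l Wp) (D k l) Dlk.
Qed.

(** In the contracted pair of indices a Jacobian meets its inverse and cancels, which leaves one
    Jacobian for each of the two free lower indices. *)
Lemma ricci_change p j l : W p -> ricci g c j l p =
  \sum_a \sum_b J p a j * J p b l * ricci g c' a b p.
Proof.
move=> Wp; have [cp cp'] := Wp.
pose Y m : 'M[R]_n := (\sum_b J p b l *: Riem c' m b p) *m J p.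
have F a : Riem c a l p = jac c' c p *m \sum_m J p m a *: Y m.
  rewrite -[LHS]mul1mx -(jac_invV Wp) -mulmxA curvature_mx_change //.
  congr (_ *m _); rewrite mulmx_suml; apply: eq_bigr => m _.
  rewrite /Y scalemxAl; congr (_ *m _); rewrite scaler_sumr.
  by apply: eq_bigr => b _; rewrite scalerA.
rewrite (ricciE g cp).
transitivity (\sum_m Y m m j).
  transitivity (\sum_m \sum_b (J p *m jac c' c p) m b * Y m b j).
    under eq_bigr => a _ do rewrite F mxE.
    rewrite exchange_big /=.
    under eq_bigr => b _ do under eq_bigr => a _ do rewrite summxE mulr_sumr.
    under eq_bigr => b _ do rewrite exchange_big /=.
    rewrite exchange_big /=; apply: eq_bigr => m _; apply: eq_bigr => b _.
    rewrite [X in X * _]mxE mulr_suml; apply: eq_bigr => a _.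
    by rewrite [X in _ * X]mxE mulrCA mulrA.
  apply: eq_bigr => m _; rewrite jac_inv // (bigD1 m) //= big1 => [|b bm].
    by rewrite mxE eqxx mul1r addr0.
  by rewrite mxE eq_sym (negbTE bm) mul0r.
under eq_bigr => m _ do rewrite mxE.
rewrite exchange_big /=; apply: eq_bigr => d _.
under eq_bigr => m _ do rewrite summxE mulr_suml.
rewrite exchange_big /=; apply: eq_bigr => b _.
rewrite (ricciE g cp') mulr_sumr; apply: eq_bigr => m _.
by rewrite [X in X * _]mxE mulrAC [J p b l * J p d j]mulrC.
Qed.

End ChartChange.

(** * Curvature of projectively related connections *)

Section ProjectiveChange.
Variables (R : realType) (n : nat) (M : manifold R n) (g h : metric M).
Variables (c : chart M) (Y : 'I_n -> M -> R).
Hypothesis n2 : (2 <= n)%N.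
Hypothesis sY : forall k, chart_smooth c (cdom c) (Y k).
Hypothesis ghY : forall q, cdom c q -> forall i j k,
  christoffel h c i k j q =
  christoffel g c i k j q + (i == j)%:R * Y k q + (i == k)%:R * Y j q.

Let cc := chart_nbh_cdom c.

Lemma sum_deltar (f : 'I_n -> R) j : \sum_m f m * (m == j)%:R = f j.
Proof.
rewrite (bigD1 j) //= eqxx mulr1 big1 ?addr0 // => m /negbTE ->.
by rewrite mulr0.
Qed.

Lemma sum_deltal (f : 'I_n -> R) j : \sum_m (j == m)%:R * f m = f j.
Proof.
by under eq_bigr => m _ do rewrite eq_sym mulrC; rewrite sum_deltar.
Qed.

Variable p : M.
Hypothesis cp : cdom c p.

(* Q_{kj} = nabla_k Y_j - Y_k Y_j *)
Let Q k j : R := pd c k (Y j) p - Y k p * Y j p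
  - \sum_m Y m p * christoffel_mx g c k p m j.

Lemma curvature_projective_change i j k l :
  riemann h c i j k l p = riemann g c i j k l p
  + (i == l)%:R * Q k j - (i == k)%:R * Q l j + (i == j)%:R * (Q k l - Q l k).
Proof.
rewrite !curvatureE // !curvature_mxE.
have D a b : dmx c a (christoffel_mx h c b) p i j =
    dmx c a (christoffel_mx g c b) p i j + (i == j)%:R * pd c a (Y b) p
    + (i == b)%:R * pd c a (Y j) p.
  rewrite !dmxE -!(pdZ cc _ _ (sY _) cp).
  have sZ t d := chart_smoothZ cc d (sY t).
  have sG : chart_smooth c (cdom c) (fun q => christoffel_mx g c b q i j).
    exact: smooth_christoffel.
  rewrite -(pdD _ sG (sZ b _) cp) -(pdD _ (chart_smoothD cc sG (sZ b _)) (sZ j _) cp).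
  by apply: (pd_ext cc) => // q cq; rewrite /= !christoffel_mxE ghY.
have S a b : \sum_m christoffel_mx h c a p i m * christoffel_mx h c b p m j =
    \sum_m christoffel_mx g c a p i m * christoffel_mx g c b p m j
    + Y b p * christoffel_mx g c a p i j + Y j p * christoffel_mx g c a p i b
    + Y a p * christoffel_mx g c b p i j + Y a p * Y b p * (i == j)%:R
    + Y a p * Y j p * (i == b)%:R
    + (i == a)%:R * (\sum_m Y m p * christoffel_mx g c b p m j)
    + (i == a)%:R * Y b p * Y j p + (i == a)%:R * Y j p * Y b p.
  (* Every term is written as a sum over m against Kronecker deltas, so that the identity holds
     summand by summand. *)
  rewrite -!(sum_deltar (fun m => christoffel_mx g c a p i m)).
  rewrite -(sum_deltal (fun m => christoffel_mx g c b p m j) i).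
  rewrite -(sum_deltal (fun m => (m == j)%:R) i) -(sum_deltal (fun m => (m == b)%:R) i).
  rewrite -[in X in _ + X + _](sum_deltar (fun m => Y m p) j).
  rewrite -[in X in _ + X](sum_deltar (fun m => Y m p) b).
  rewrite !mulr_sumr -!big_split /=; apply: eq_bigr => m _.
  rewrite !christoffel_mxE !ghY //; ring.
rewrite !D !S /Q (christoffel_sym g cp k i l).
have -> : \sum_m Y m p * christoffel_mx g c l p m k =
          \sum_m Y m p * christoffel_mx g c k p m l.
  by apply: eq_bigr => m _; rewrite (christoffel_sym g cp).
ring.
Qed.

Lemma ricci_projective_change j l :
  ricci h c j l p = ricci g c j l p + Q j l - n%:R * Q l j.
Proof.
rewrite /ricci (eq_bigr (fun a => riemann g c a j a l p + Q a j * (a == l)%:R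
    - Q l j + (Q a l - Q l a) * (a == j)%:R)) => [|a _]; last first.
  by rewrite curvature_projective_change eqxx mul1r [_ * Q a j]mulrC [_%:R * (_ - _)]mulrC.
rewrite 3!big_split /= !sum_deltar sumrN sumr_const card_ord -[Q l j *+ n]mulr_natl.
by move: (\sum_a _) (Q j l) (Q l j) => r x y; ring.
Qed.

Lemma weyl_projective_change i j k l : weyl h c i j k l p = weyl g c i j k l p.
Proof.
have n0 : n%:R + 1 != 0 :> R by rewrite natr1 pnatr_eq0.
have n1 : (n.-1)%:R != 0 :> R by rewrite pnatr_eq0 -lt0n -ltnS prednK // (ltn_trans _ n2).
have nE : n%:R = (n.-1)%:R + 1 :> R by rewrite natr1 prednK // (ltn_trans _ n2).
(* Subtracting the changes of Ric_{ab} and Ric_{ba} gives (n + 1) (Q_{ab} - Q_{ba}) = 0. *)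
have Qsym a b : Q a b = Q b a.
  have := ricci_sym h cp a b; rewrite !ricci_projective_change (ricci_sym g cp a b).
  move=> e; apply: (mulfI n0); lra.
(* For symmetric Q the Ricci tensor changes by (1 - n) Q, and the factor 1/(n - 1) in the Schouten
   tensor is what makes this exactly - Q. *)
have P a b : schouten h c a b p = schouten g c a b p - Q a b.
  rewrite /schouten ricci_projective_change (Qsym b a) nE; field.
  exact: n1.
rewrite /weyl curvature_projective_change !P (Qsym k l) (Qsym j k) (Qsym j l).
ring.
Qed.

End ProjectiveChange.

(** * Existence of geodesics *)

Section BoundedLipschitz.
Variables (R : realType) (I : finType).
Implicit Types f g : (I -> R) -> R.

(** Boundedness is carried along because a product of unbounded Lipschitz functions need not be
    Lipschitz. *)
Definition bounded_lipschitz f := exists B L : R, [/\ 0 <= B, 0 <= L,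
  forall u, `|f u| <= B &
  forall u w d, (forall j, `|u j - w j| <= d) -> `|f u - f w| <= L * d].

Lemma bounded_lipschitz_cst (a : R) : bounded_lipschitz (fun=> a).
Proof.
by exists `|a|, 0; split=> // u w d _; rewrite subrr normr0 mul0r.
Qed.

Lemma bounded_lipschitzD f g : bounded_lipschitz f -> bounded_lipschitz g ->
  bounded_lipschitz (fun u => f u + g u).
Proof.
move=> [B [L [B0 L0 fB fL]]] [B' [L' [B'0 L'0 gB gL]]].
exists (B + B'), (L + L'); split; [exact: addr_ge0|exact: addr_ge0|move=> u|move=> u w d uw].
  by apply: le_trans (ler_normD _ _) _; exact: lerD.
rewrite opprD addrACA mulrDl; apply: le_trans (ler_normD _ _) _.
by apply: lerD; [exact: fL|exact: gL].
Qed.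

Lemma bounded_lipschitzM f g : bounded_lipschitz f -> bounded_lipschitz g ->
  bounded_lipschitz (fun u => f u * g u).
Proof.
move=> [B [L [B0 L0 fB fL]]] [B' [L' [B'0 L'0 gB gL]]].
exists (B * B'), (L * B' + B * L'); split.
- exact: mulr_ge0.
- by apply: addr_ge0; exact: mulr_ge0.
- by move=> u; rewrite normrM; apply: ler_pM.
move=> u w d uw; rewrite (_ : _ - _ = (f u - f w) * g u + f w * (g u - g w)); last by ring.
apply: le_trans (ler_normD _ _) _; rewrite !normrM mulrDl.
rewrite -mulrA [B' * d]mulrC mulrA -[B * L' * d]mulrA.
by apply: lerD; apply: ler_pM => //; [exact: fL|exact: gL].
Qed.

Lemma bounded_lipschitz_sum (K : Type) (r : seq K) (f : K -> (I -> R) -> R) :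
  (forall k, bounded_lipschitz (f k)) ->
  bounded_lipschitz (fun u => \sum_(k <- r) f k u).
Proof.
move=> H; elim: r => [|k r IH].
  by under eq_fun do rewrite big_nil; exact: bounded_lipschitz_cst.
by under eq_fun do rewrite big_cons; exact: bounded_lipschitzD.
Qed.

Lemma bounded_lipschitz_clamp (a b : R) (i : I) : a <= b ->
  bounded_lipschitz (fun u => clamp a b (u i)).
Proof.
move=> ab; exists (Num.max `|a| `|b|), 1; split=> //.
- move=> u; have := clamp_in (u i) ab; move: (clamp _ _ _) => x /andP[ax xb].
  rewrite le_max; apply/orP; have [x0|x0] := leP 0 x.
    by right; rewrite (ger0_norm x0) (le_trans xb) // ler_norm.
  left; rewrite (ltr0_norm x0) ltr0_norm ?lerN2 //; exact: le_lt_trans x0.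
- by move=> u w d uw; rewrite mul1r (le_trans (clamp_lipschitz _ _ ab)).
Qed.

Lemma Picard_bounded_lipschitz (F : I -> (I -> R) -> R) (y0 : I -> R) :
  (forall i, bounded_lipschitz (F i)) ->
  exists2 e : R, 0 < e & exists y : I -> R -> R, (forall i, y i 0 = y0 i) /\
    forall t : R, `|t| < e -> forall i, is_derive t 1 (y i) (F i (fun j => y j t)).
Proof.
move=> BL.
have LE i : exists L : R, 0 <= L /\ forall u w d, (forall j, `|u j - w j| <= d) ->
    `|F i u - F i w| <= L * d.
  by have [B [L [_ L0 _ FL]]] := BL i; exists L.
pose L i := sval (cid (LE i)).
have L0 i : 0 <= L i by exact: (svalP (cid (LE i))).1.
apply: (@Picard_Lindelof R I (fun u i => F i u) (\sum_i L i)) => u w d uw i.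
apply: le_trans ((svalP (cid (LE i))).2 u w d uw) _.
apply: ler_wpM2r; first exact: le_trans (uw i).
by rewrite (bigD1 i) //= lerDl sumr_ge0.
Qed.

End BoundedLipschitz.

Section SmoothLocalBounds.
Variables (R : realType) (n : nat).

Lemma smooth_near_bound (U : set 'rV[R]_n) f u : open U -> smooth_on U f -> U u ->
  exists B : R, \forall w \near u, `|f w| <= B /\ forall i, `|'D_'e_i f w| <= B.
Proof.
move=> oU sf Uu.
pose S := \sum_(i < n) `|'D_'e_i f u|.
have S0 : 0 <= S by exact: sumr_ge0.
pose B := `|f u| + S + 1; exists B.
have N h : smooth_on U h -> `|h u| <= `|f u| + S ->
    \forall w \near u, `|h w| <= B.
  move=> sh hB; have /cvgrPdist_lt /(_ 1 ltr01) := (sh 0%N).1 u Uu.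
  apply: filterS => w hw; rewrite /B.
  have := ler_distD (h u) (h w) 0; rewrite !subr0 (distrC (h w)); lra.
have N1 : \forall w \near u, `|f w| <= B by apply: N => //; rewrite lerDl.
have N2 : \forall w \near u, forall i, `|'D_'e_i f w| <= B.
  apply: (@filter_forall _ _ _ _ (nbhs_filter u)) => i; apply: N.
    exact: smooth_derive.
  by rewrite /S (bigD1 i) //= addrCA lerDl addr_ge0 // sumr_ge0.
exact: (filterI N1 N2).
Qed.

(* Clamped to a box around u, a smooth function becomes globally Lipschitz, as
   the Picard iteration requires. *)
Lemma smooth_clamp_bounded_lipschitz (I : finType) (pos : 'I_n -> I)
    (U : set 'rV[R]_n) (f : 'rV[R]_n -> R) u r B :
  0 < r -> box u r `<=` U -> smooth_on U f ->
  (forall w, box u r w -> `|f w| <= B /\ forall i, `|'D_'e_i f w| <= B) ->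
  bounded_lipschitz (fun y : I -> R => f (\row_i
    clamp (u ord0 i - r / 2) (u ord0 i + r / 2) (y (pos i)))).
Proof.
move=> r0 rU sf H; set cl := fun y : I -> R => _.
have ab i : u ord0 i - r / 2 <= u ord0 i + r / 2 by lra.
have bcl y : box u r (\row_i
    clamp (u ord0 i - r / 2) (u ord0 i + r / 2) (y (pos i))).
  move=> i; rewrite mxE; have /andP[? ?] := clamp_in (y (pos i)) (ab i).
  by rewrite ltr_norml; apply/andP; split; lra.
have bu : box u r u by move=> i; rewrite subrr normr0.
have B0 : 0 <= B by exact: le_trans (normr_ge0 _) (H u bu).1.
exists B, (n%:R * B); split=> // [|y|y z d yz].
- by rewrite mulr_ge0.
- exact: (H _ (bcl y)).1.
apply: le_trans (partial_bound (K := fun=> B) _ (bcl y) (bcl z)) _.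
  move=> w bw i; split; last exact: (H w bw).2.
  exact: smooth_derivable sf (rU _ bw).
apply: le_trans (_ : \sum_(i < n) B * d <= _).
  apply: ler_sum => i _; apply: ler_wpM2l => //; rewrite !mxE.
  exact: le_trans (clamp_lipschitz _ _ (ab i)) (yz _).
by rewrite sumr_const card_ord -[_ *+ n]mulr_natl mulrA.
Qed.

End SmoothLocalBounds.

Section GeodesicExistence.
Variables (R : realType) (n : nat) (M : manifold R n) (g : metric M).
Variable c : chart M.

Let cc := chart_nbh_cdom c.
Let oU := open_cmap_image cc.

Lemma smooth_christoffel_coord i j k :
  smooth_on (cmap c @` cdom c) (christoffel g c i j k \o cinv c).
Proof.
move=> m; apply: Ck_ext (smooth_christoffel g c j i k m) => // u _.
by rewrite /= christoffel_mxE.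
Qed.

(** The equation becomes a first-order system for positions and velocities, indexed by
    ['I_n + 'I_n]. Positions are clamped to a box of half-width r/2 inside the chart image and
    velocities to within 1 of V, which makes the vector field globally Lipschitz. *)
Lemma geodesic_ODE p (V : 'I_n -> R) : cdom c p ->
  exists2 e : R, 0 < e & exists (x : R -> 'rV[R]_n) (v : 'I_n -> R -> R),
    [/\ x 0 = cmap c p, (forall i, v i 0 = V i) &
    forall t : R, `|t| < e -> (cmap c @` cdom c) (x t) /\ forall i,
      is_derive t 1 (fun s => x s ord0 i) (v i t) /\
      is_derive t 1 (v i) (- \sum_j \sum_k
        christoffel g c i j k (cinv c (x t)) * v j t * v k t)].
Proof.
move=> cp; set x0 := cmap c p.
have Ux0 : (cmap c @` cdom c) x0 by exact: cmap_image.
have [B [r [r0 rU HB]]] : exists (B : 'I_n -> 'I_n -> 'I_n -> R) (r : R),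
    [/\ 0 < r, box x0 r `<=` cmap c @` cdom c &
    forall i j k w, box x0 r w -> `|(christoffel g c i j k \o cinv c) w| <= B i j k /\
      forall m, `|'D_'e_m (christoffel g c i j k \o cinv c) w| <= B i j k].
  have HB i j k := smooth_near_bound oU (smooth_christoffel_coord i j k) Ux0.
  pose B i j k := sval (cid (HB i j k)); exists B.
  have NU : \forall w \near x0, (cmap c @` cdom c) w by exact: (near_open oU Ux0).
  have NB : \forall w \near x0, forall a : 'I_n * 'I_n * 'I_n,
      `|(christoffel g c a.1.1 a.1.2 a.2 \o cinv c) w| <= B a.1.1 a.1.2 a.2 /\
      forall m, `|'D_'e_m (christoffel g c a.1.1 a.1.2 a.2 \o cinv c) w|
        <= B a.1.1 a.1.2 a.2.
    apply: (@filter_forall _ _ _ _ (nbhs_filter x0)) => -[[i j] k].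
    exact: (svalP (cid (HB i j k))).
  have [r r0 Hr] := (nbhs_boxP x0 _).1 (@filterI _ _ (nbhs_filter x0) _ _ NU NB).
  exists r; split=> // [w /Hr[]//|i j k w /Hr[_ /(_ (i, j, k))]].
  by [].
pose I := ('I_n + 'I_n)%type.
pose y0 (a : I) := match a with inl i => x0 ord0 i | inr i => V i end.
pose cx (y : I -> R) : 'rV[R]_n := \row_i
  clamp (x0 ord0 i - r / 2) (x0 ord0 i + r / 2) (y (inl i)).
pose cv (y : I -> R) i := clamp (V i - 1) (V i + 1) (y (inr i)).
pose F (a : I) (y : I -> R) := match a with
  | inl i => cv y i
  | inr i => -1 * \sum_j \sum_k christoffel g c i j k (cinv c (cx y)) * cv y j * cv y k
  end.
have vV i : V i - 1 <= V i + 1 by lra.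
have BLF a : bounded_lipschitz (F a).
  case: a => i; first exact: bounded_lipschitz_clamp.
  apply: bounded_lipschitzM; first exact: bounded_lipschitz_cst.
  apply: bounded_lipschitz_sum => j; apply: bounded_lipschitz_sum => k.
  apply: bounded_lipschitzM; last exact: bounded_lipschitz_clamp.
  apply: bounded_lipschitzM; last exact: bounded_lipschitz_clamp.
  apply: (smooth_clamp_bounded_lipschitz (fun i : 'I_n => inl i : I) r0 rU
    (smooth_christoffel_coord i j k) (HB i j k)).
have [e0 e00 [y [yE yD]]] := Picard_bounded_lipschitz y0 BLF.
(* By continuity the solution stays within the clamping ranges for short times, and there it solves
   the unclamped system. *)
have N : \forall t \near (0 : R), `|t| < e0 /\ forall a,
    `|y a t - y0 a| < Num.min 1 (r / 2).
  have m0 : 0 < Num.min 1 (r / 2) by rewrite lt_min ltr01 divr_gt0.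
  apply: (@filterI _ _ (nbhs_filter (0 : R))).
    by apply: filterS (nbhsx_ballx 0 _ e00) => t; rewrite /ball /= sub0r normrN.
  apply: (@filter_forall _ _ _ _ (nbhs_filter (0 : R))) => a.
  have D0 : is_derive (0 : R) 1 (y a) (F a (y^~ 0)) by apply: yD; rewrite normr0.
  have /cvgrPdist_lt /(_ _ m0) := is_derive1_continuous D0.
  by apply: filterS => t; rewrite yE distrC.
have [e /= e0' He] := (nbhs_ballP _ _).1 N.
exists e => //; exists (fun t => \row_i y (inl i) t), (fun i => y (inr i)); split.
- by apply/rowP => i; rewrite mxE yE.
- by move=> i; rewrite yE.
move=> t te.
have [te0 ty] : `|t| < e0 /\ forall a, `|y a t - y0 a| < Num.min 1 (r / 2).
  by apply: He; rewrite /ball /= sub0r normrN.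
have xE : cx (fun a => y a t) = \row_i y (inl i) t.
  apply/rowP => i; rewrite !mxE clamp_id //.
  have := ty (inl i); rewrite lt_min !ltr_norml /= => /andP[_ /andP[? ?]].
  by apply/andP; split; lra.
have vE i : cv (fun a => y a t) i = y (inr i) t.
  rewrite /cv clamp_id //.
  have := ty (inr i); rewrite lt_min !ltr_norml /= => /andP[/andP[? ?] _].
  by apply/andP; split; lra.
split.
  apply: rU => i; rewrite mxE.
  have := ty (inl i); rewrite lt_min /= => /andP[_ /lt_trans]; apply; lra.
move=> i; split.
  have := yD t te0 (inl i); rewrite /F vE.
  by under [in X in _ -> X]eq_fun do rewrite mxE.
apply: is_derive_eq (yD t te0 (inr i)) _.
rewrite /F mulN1r xE; congr (- _); apply: eq_bigr => j _; apply: eq_bigr => k _.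
by rewrite !vE.
Qed.

End GeodesicExistence.

Section GeodesicCharts.
Variables (R : realType) (n : nat) (M : manifold R n) (g : metric M).
Implicit Types (c : chart M) (p q : M).

Lemma christoffel_quadE c q (v : 'cV[R]_n) i :
  (\sum_k v k ord0 *: (christoffel_mx g c k q *m v)) i ord0 =
  \sum_j \sum_k christoffel g c i j k q * v j ord0 * v k ord0.
Proof.
rewrite summxE; apply: eq_bigr => j _; rewrite !mxE mulr_sumr.
by apply: eq_bigr => k _; rewrite christoffel_mxE mulrA [v j ord0 * _]mulrC.
Qed.

(** The inhomogeneous term is the derivative of the Jacobian along v, applied to v: exactly what
    appears when the velocity J v of a curve is differentiated once more. *)
Lemma christoffel_quad_change c c' q (v : 'cV[R]_n) : cdom c q -> cdom c' q ->
  jac c c' q *m (\sum_k v k ord0 *: (christoffel_mx g c k q *m v)) =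
  \sum_k (jac c c' q *m v) k ord0 *: (christoffel_mx g c' k q *m (jac c c' q *m v))
  + \sum_k v k ord0 *: (dmx c k (jac c c') q *m v).
Proof.
move=> cq cq'; rewrite mulmx_sumr.
under eq_bigr => k _ do rewrite -scalemxAr mulmxA christoffel_mx_change //
  mulmxDl scalerDr.
rewrite big_split /=; congr (_ + _).
under [RHS]eq_bigr => m _ do rewrite mxE scaler_suml.
rewrite exchange_big /=; apply: eq_bigr => k _.
rewrite -mulmxA mulmx_suml scaler_sumr; apply: eq_bigr => m _.
by rewrite -scalemxAl scalerA mulrC.
Qed.

Lemma is_derive_curve c W (f : M -> R) (x : R -> 'rV[R]_n) (v : 'I_n -> R) (t : R) :
  chart_nbh c W -> chart_smooth c W f -> (cmap c @` W) (x t) ->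
  (forall i, is_derive t 1 (fun s => x s ord0 i) (v i)) ->
  is_derive t 1 (fun s => f (cinv c (x s))) (\sum_b pd c b f (cinv c (x t)) * v b).
Proof.
move=> cW sf Wx dx; have [_ xE] := cinv_image cW Wx.
have dxt : derivable x t 1.
  by apply/derivable_mxP => a i; rewrite (ord1 a); have [] := dx i.
have dfx := smooth_differentiable (open_cmap_image cW) sf Wx.
apply: is_derive_eq (derive_compE dfx dxt) _.
apply: eq_bigr => b _; rewrite /pd xE; congr (_ * _).
by have [] := dx b.
Qed.

(** The solution is found in c, but [geodesic] asks for the equation in every chart c' along the
    curve. There the velocity is J v, and its derivative is computed by the product rule and
    compared with [christoffel_quad_change]. *)
Lemma geodesic_exists c p (V : 'I_n -> R) : cdom c p ->
  exists (I : set R) (gamma : R -> M), [/\ geodesic g I gamma, I 0, gamma 0 = p &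
    forall i, derive1 (fun s => cmap c (gamma s) ord0 i) 0 = V i].
Proof.
move=> cp; have [e e0 [x [v [x0 v0 ode]]]] := geodesic_ODE g V cp.
pose I := [set` `](- e), e[].
have IE t : I t -> `|t| < e by rewrite /I /= in_itv /= ltr_norml.
have I0 : I 0 by rewrite /I /= in_itv /= oppr_lt0 e0.
have oI : open I by exact: interval_open.
pose gamma t := cinv c (x t).
have cc := chart_nbh_cdom c.
have xcont t : I t -> {for t, continuous x}.
  move=> /IE te; apply: continuous_coords => i.
  exact: is_derive1_continuous ((ode t te).2 i).1.
have Gcont t : I t -> {for t, continuous gamma}.
  move=> It; apply: continuous_comp; first exact: xcont.
  exact: cinv_continuous (ode t (IE _ It)).1.
have dX c' t i : I t -> cdom c' (gamma t) ->
    is_derive t 1 (fun s => cmap c' (gamma s) ord0 i)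
      (\sum_a jac c c' (gamma t) i a * v a t).
  move=> It ct; have [Ux d] := ode t (IE _ It).
  pose W := cdom c `&` cdom c'.
  have cW : chart_nbh c W by apply: chart_nbhI => //; exact: cdom_open.
  have cW' : chart_nbh c' W.
    by rewrite /W setIC; apply: chart_nbhI; [exact: chart_nbh_cdom|exact: cdom_open].
  have [cx xE] := cinv_image cc Ux.
  have Wx : (cmap c @` W) (x t) by exists (gamma t).
  apply: is_derive_eq (is_derive_curve cW (chart_smooth_coord cW cW' i) Wx (fun a => (d a).1)) _.
  by apply: eq_bigr => a _; rewrite mxE.
exists I, gamma; split=> //.
- split; first by split=> //; [exact: interval_is_interval|exists 0].
  move=> t It; split; first exact: Gcont.
  move=> c' ct X i.
  have NI : \forall s \near t, I s by exact: open_nbhs_nbhs.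
  have NW : \forall s \near t, cdom c' (gamma s).
    by apply: (Gcont t It); apply: open_nbhs_nbhs; split=> //; exact: cdom_open.
  have [Ux d] := ode t (IE _ It); have [cx xE] := cinv_image cc Ux.
  (* The velocity in c', identified with the derivative of the coordinates at all times near t,
     since it is differentiated again. *)
  pose w j s := \sum_a jac c c' (gamma s) j a * v a s.
  have Xw : \forall s \near t, forall j, w j s = derive1 (X j) s.
    apply: (@filterS2 _ _ (nbhs_filter t) _ _ _ _ NI NW) => s Is cs j.
    by rewrite derive1E; have [_ ->] := dX c' s j Is cs.
  have dw : is_derive t 1 (w i) (\sum_a
      (jac c c' (gamma t) i a * (- \sum_j \sum_k
        christoffel g c a j k (gamma t) * v j t * v k t) +
       (\sum_b pd c b (fun q => jac c c' q i a) (gamma t) * v b t) * v a t)).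
    have dva a : is_derive t 1 (fun s => jac c c' (gamma s) i a * v a s)
        (jac c c' (gamma t) i a * (- \sum_j \sum_k
          christoffel g c a j k (gamma t) * v j t * v k t) +
         (\sum_b pd c b (fun q => jac c c' q i a) (gamma t) * v b t) * v a t).
      pose W := cdom c `&` cdom c'.
      have cW : chart_nbh c W by apply: chart_nbhI => //; exact: cdom_open.
      have cW' : chart_nbh c' W.
        by rewrite /W setIC; apply: chart_nbhI; [exact: chart_nbh_cdom|exact: cdom_open].
      have Wx : (cmap c @` W) (x t) by exists (gamma t).
      have dJ := is_derive_curve cW (smooth_jac cW cW' i a) Wx (fun b => (d b).1).
      apply: is_derive_eq (is_deriveM dJ (d a).2) _.
      by rewrite /GRing.scale /= [v a t * _]mulrC.
    rewrite (_ : w i = \sum_a (fun s => jac c c' (gamma s) i a * v a s)).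
      exact: is_derive_sum.
    by apply: funext => s; rewrite fct_sumE.
  have dX1 : is_derive t 1 (derive1 (X i)) (\sum_a
      (jac c c' (gamma t) i a * (- \sum_j \sum_k
        christoffel g c a j k (gamma t) * v j t * v k t) +
       (\sum_b pd c b (fun q => jac c c' q i a) (gamma t) * v b t) * v a t)).
    apply: near_eq_is_derive dw.
    by apply: filterS Xw => s; exact.
  have [dX0 _] := dX c' t i It ct; have [dX1d dX1E] := dX1.
  split=> //; rewrite /derive1n /= derive1E dX1E.
  pose vt : 'cV[R]_n := \col_a v a t.
  have wE j : (jac c c' (gamma t) *m vt) j ord0 = derive1 (X j) t.
    have [_ dE] := dX c' t j It ct; rewrite derive1E dE mxE.
    by apply: eq_bigr => a _; rewrite [vt _ _]mxE.
  have := christoffel_quad_change vt cx ct.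
  move=> /matrixP/(_ i ord0); rewrite mxE [X in _ = X -> _]mxE christoffel_quadE => E.
  rewrite big_split /= addrAC.
  rewrite (_ : \sum_j \sum_k _ = \sum_j \sum_k christoffel g c' i j k (gamma t) *
    (jac c c' (gamma t) *m vt) j ord0 * (jac c c' (gamma t) *m vt) k ord0); last first.
    by apply: eq_bigr => j _; apply: eq_bigr => k _; rewrite !wE.
  (* A is J applied to the acceleration given by the equation in c, B the quadratic Christoffel term
     in c', and C comes from differentiating J; [christoffel_quad_change] says that they add up to
     0. *)
  rewrite -addrA; set A := \sum_a _ * _; set B := \sum_j _; set C := \sum_a _ * _.
  have AE : A = - \sum_a jac c c' (gamma t) i a *
      (\sum_k vt k ord0 *: (christoffel_mx g c k (gamma t) *m vt)) a ord0.
    rewrite -sumrN; apply: eq_bigr => a _; rewrite christoffel_quadE mulrN.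
    by under [in RHS]eq_bigr => j _ do under eq_bigr => k _ do rewrite !mxE.
  have CE : C = (\sum_k vt k ord0 *: (dmx c k (jac c c') (gamma t) *m vt)) i ord0.
    rewrite summxE; under [RHS]eq_bigr => k _ do rewrite mxE [X in _ * X]mxE mulr_sumr.
    rewrite exchange_big /=; apply: eq_bigr => a _; rewrite mulr_suml.
    apply: eq_bigr => b _; rewrite dmxE !mxE.
    by rewrite mulrA [v b t * _]mulrC.
  by rewrite AE E CE -/B [B + _]addrC addNr.
- by rewrite /gamma x0 cmapK.
move=> i; rewrite derive1E.
have cg : cdom c (gamma 0) by rewrite /gamma x0 cmapK.
have [_ ->] := dX c 0 i I0 cg.
rewrite jac_id // (bigD1 i) //= mxE eqxx mul1r v0 big1 ?addr0 // => a ai.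
by rewrite mxE eq_sym (negbTE ai) mul0r.
Qed.

End GeodesicCharts.

(** * Projective equivalence *)

Section Reparametrisation.
Variables (R : realType) (n : nat) (M : manifold R n).
Implicit Types (c : chart M) (p q : M) (g h : metric M).

Lemma derivable1_is_derive (f : R -> R) (t : R) :
  derivable f t 1 -> is_derive t 1 f (derive1 f t).
Proof. by move=> df; rewrite derive1E; exact: derivableP. Qed.

Lemma is_derive_derive1 (f : R -> R) (t d : R) :
  is_derive t 1 f d -> derive1 f t = d.
Proof. by move=> [_ <-]; rewrite derive1E. Qed.

Lemma derive1_comp2 (f phi : R -> R) (s : R) :
  (\forall t \near s, derivable phi t 1 /\ derivable f (phi t) 1) ->
  derivable (derive1 f) (phi s) 1 -> derivable (derive1 phi) s 1 ->
  derive1 (f \o phi) s = derive1 f (phi s) * derive1 phi s /\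
  derive1n 2 (f \o phi) s =
    derive1n 2 f (phi s) * derive1 phi s ^+ 2 + derive1 f (phi s) * derive1n 2 phi s.
Proof.
move=> N d2f d2p; have [dp df] := nbhs_singleton N.
have C t : derivable phi t 1 -> derivable f (phi t) 1 ->
    derive1 f (phi t) * derive1 phi t = derive1 (f \o phi) t.
  move=> dpt dft; apply/esym/is_derive_derive1.
  exact: (is_derive1_comp (derivable1_is_derive dft) (derivable1_is_derive dpt)).
split; first exact/esym/C.
have E : \forall t \near s, derive1 f (phi t) * derive1 phi t = derive1 (f \o phi) t.
  by apply: filterS N => t [dpt dft]; exact: C.
have dc := is_derive1_comp (derivable1_is_derive d2f) (derivable1_is_derive dp).
have dd := is_deriveM dc (derivable1_is_derive d2p).
rewrite [LHS](is_derive_derive1 (near_eq_is_derive E dd)).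
rewrite /GRing.scale /= expr2 addrC; congr (_ + _).
by rewrite mulrCA mulrA.
Qed.

(** Here d1 and d2 are the first two derivatives of the parameter change, and a, b one component of
    the quadratic Christoffel terms of h and g at the velocity of component v. The hypothesis is the
    equation of h along the reparametrised curve, with the equation of g inserted. *)
Lemma solve_for_difference (d1 d2 v a b : R) : d1 != 0 ->
  - b * d1 ^+ 2 + v * d2 + d1 ^+ 2 * a = 0 -> a - b = - d2 / d1 ^+ 2 * v.
Proof.
move=> d10 e; apply: (mulfI (expf_neq0 2 d10)).
rewrite (_ : d1 ^+ 2 * (- d2 / d1 ^+ 2 * v) = - d2 * v); last by field.
lra.
Qed.

Lemma reparametrise_christoffel g h c p (V : 'I_n -> R) :
  geodesics_reparametrise g h -> cdom c p ->
  exists mu : R, forall i,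
    \sum_j \sum_k (christoffel h c i j k p - christoffel g c i j k p) * V j * V k
    = mu * V i.
Proof.
move=> H cp; have [I [gam [gI I0 gam0 gamV]]] := geodesic_exists g V cp.
have [J [phi [[oJ phiJ dphi phi0] hJ]]] := H I gam gI.
have [s Js phis] : (phi @` J) 0 by rewrite phiJ.
have IJ t : J t -> I (phi t) by move=> Jt; rewrite -phiJ; exists t.
pose d1 := derive1 phi s; pose d2 := derive1n 2 phi s.
(* The factor depends on the parameter change alone, hence is common to all components i. *)
exists (- d2 / d1 ^+ 2) => i.
have d10 : d1 != 0 by exact: phi0.
have cg : cdom c (gam 0) by rewrite gam0.
have ch : cdom c ((gam \o phi) s) by rewrite /= phis gam0.
have [conth /(_ c ch) hgeo] := hJ.2 s Js.
have [_ /(_ c cg) ggeo] := gI.2 0 I0.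
pose X j t := cmap c (gam t) ord0 j.
have NJ : \forall t \near s, J t by apply: open_nbhs_nbhs; split=> //; case: oJ.
have Nc : \forall t \near s, cdom c (gam (phi t)).
  by apply: conth; apply: open_nbhs_nbhs; split=> //; exact: cdom_open.
have D j : derive1 (X j \o phi) s = V j * d1 /\
    derive1n 2 (X j \o phi) s = derive1n 2 (X j) 0 * d1 ^+ 2 + V j * d2.
  have [_ dX2 _] := ggeo j.
  have N2 : \forall t \near s, derivable phi t 1 /\ derivable (X j) (phi t) 1.
    apply: (@filterS2 _ _ (nbhs_filter s) _ _ _ _ NJ Nc) => t Jt ct.
    have [_ /(_ c ct j)[dXj _ _]] := gI.2 (phi t) (IJ t Jt).
    by split; [exact: (dphi 0%N t Jt)|exact: dXj].
  have K := @derive1_comp2 (X j) phi s N2; rewrite phis in K.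
  have {K} := K dX2 (dphi 1%N s Js).
  by rewrite (gamV j : derive1 (X j) 0 = _).
have [_ _ gE] := ggeo i; have [_ _ hE] := hgeo i.
pose Sg := \sum_(j < n) \sum_(k < n) christoffel g c i j k p * V j * V k.
pose Sh := \sum_(j < n) \sum_(k < n) christoffel h c i j k p * V j * V k.
have gE' : derive1n 2 (X i) 0 = - Sg.
  apply/eqP; rewrite -addr_eq0 -[X in _ == X]gE; apply/eqP; congr (_ + _).
  apply: eq_bigr => j _; apply: eq_bigr => k _.
  by rewrite gam0 (gamV j : derive1 (X j) 0 = _) (gamV k : derive1 (X k) 0 = _).
have hE' : derive1n 2 (X i \o phi) s + d1 ^+ 2 * Sh = 0.
  rewrite -[RHS]hE; congr (_ + _); rewrite mulr_sumr; apply: eq_bigr => j _.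
  rewrite mulr_sumr; apply: eq_bigr => k _.
  rewrite /= phis gam0 -[X in _ = _ * X * _]/(derive1 (X j \o phi) s).
  rewrite -[X in _ = _ * X]/(derive1 (X k \o phi) s) (D j).1 (D k).1.
  ring.
rewrite (D i).2 gE' in hE'.
have -> : \sum_j \sum_k (christoffel h c i j k p - christoffel g c i j k p) * V j * V k
    = Sh - Sg.
  rewrite -sumrB; apply: eq_bigr => j _; rewrite -sumrB; apply: eq_bigr => k _.
  by rewrite mulrBl mulrBl.
exact: solve_for_difference d10 hE'.
Qed.

End Reparametrisation.

(** * Quadratic maps proportional to their argument *)

Section ProportionalQuadratic.
Variables (R : realFieldType) (n : nat) (D : 'I_n -> 'I_n -> 'I_n -> R).
Hypothesis Dsym : forall i j k, D i j k = D i k j.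
Hypothesis Dprop : forall V : 'I_n -> R, exists mu, forall i,
  \sum_j \sum_k D i j k * V j * V k = mu * V i.

Let diag i j : i != j -> D i j j = 0.
Proof.
move=> ij; have [mu /(_ i)] := Dprop (fun a => (a == j)%:R).
rewrite (negbTE ij) mulr0 => <-.
rewrite (bigD1 j) //= [X in _ + X]big1 ?addr0 => [|a /negbTE aj]; last first.
  by rewrite big1 // => k _; rewrite aj mulr0 mul0r.
rewrite (bigD1 j) //= eqxx big1 ?addr0 ?mulr1 // => a /negbTE ->.
by rewrite mulr0.
Qed.

Let quad2 i j k (t : R) : j != k ->
  \sum_a \sum_b D i a b * ((a == j)%:R + t * (a == k)%:R)
    * ((b == j)%:R + t * (b == k)%:R)
  = D i j j + 2 * t * D i j k + t ^+ 2 * D i k k.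
Proof.
move=> jk; have kj : (k == j) = false by rewrite eq_sym (negbTE jk).
have inner a : \sum_b D i a b * ((a == j)%:R + t * (a == k)%:R)
    * ((b == j)%:R + t * (b == k)%:R) =
    (D i a j + t * D i a k) * ((a == j)%:R + t * (a == k)%:R).
  rewrite (bigD1 j) //= (bigD1 k) //= ?kj //.
  rewrite big1 => [|b /andP[/negbTE bj /negbTE bk]].
    by rewrite !eqxx (negbTE jk) ?kj /=; ring.
  by rewrite bj bk /=; ring.
under eq_bigr do rewrite inner.
rewrite (bigD1 j) //= (bigD1 k) //= ?kj //.
rewrite big1 => [|b /andP[/negbTE bj /negbTE bk]].
  by rewrite !eqxx (negbTE jk) ?kj (Dsym i k j) /=; ring.
by rewrite bj bk /=; ring.
Qed.

(* Test vectors e_j, e_j + e_k and e_j - e_k. *)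
Lemma proportional_quadratic i j k :
  D i j k = (i == j)%:R * (D k k k / 2) + (i == k)%:R * (D j j j / 2).
Proof.
have [<-|jk] := eqVneq j k.
  have [->|ij] := eqVneq i j; first by rewrite ?eqxx /=; field.
  by rewrite diag // !mul0r addr0.
have two : (2 : R) != 0 by rewrite pnatr_eq0.
have P t : exists mu, forall a, D a j j + 2 * t * D a j k + t ^+ 2 * D a k k =
    mu * ((a == j)%:R + t * (a == k)%:R).
  have [mu H] := Dprop (fun a => (a == j)%:R + t * (a == k)%:R).
  by exists mu => a; rewrite -H quad2.
have kj : (k == j) = false by rewrite eq_sym (negbTE jk).
(* Components j and k each determine both factors: mu1 = D_jjj + 2 D_jjk = 2 D_kjk + D_kkk and mu2 =
   D_jjj - 2 D_jjk = 2 D_kjk - D_kkk. Their difference gives D_jjk = D_kkk / 2 and their sum D_kjk =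
   D_jjj / 2; any other component i gives D_ijk = 0. *)
have [mu1 H1] := P 1; have [mu2 H2] := P (-1).
have h1j := H1 j; have h1k := H1 k; have h2j := H2 j; have h2k := H2 k.
rewrite !eqxx (negbTE jk) (diag jk) in h1j h2j.
have nkj : k != j by rewrite kj.
rewrite !eqxx kj (diag nkj) in h1k h2k.
have [ij|ij] := eqVneq i j.
  rewrite ij (negbTE jk) /=; rewrite /= in h1j h1k h2j h2k; lra.
have [ik|ik] := eqVneq i k.
  rewrite ik /=; rewrite /= in h1j h1k h2j h2k; lra.
have := H1 i; rewrite (negbTE ij) (negbTE ik) (diag ij) (diag ik) /=; lra.
Qed.

End ProportionalQuadratic.

Section ProjectiveInvariance.
Variables (R : realType) (n : nat) (M : manifold R n).

Lemma weyl_proj_equiv (g h : metric M) c p i j k l : (2 <= n)%N ->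
  proj_equiv g h -> cdom c p -> weyl h c i j k l p = weyl g c i j k l p.
Proof.
move=> n2 [gh _] cp.
(* Forced by the case i = j = k of the desired form, D_mmm = 2 Y_m; as a difference of Christoffel
   symbols it is smooth. *)
pose Y m q := (christoffel h c m m m q - christoffel g c m m m q) / 2.
apply: (@weyl_projective_change R n M g h c Y n2) => // [m|q cq i' j' k'].
  have cc := chart_nbh_cdom c.
  apply: (@chart_smooth_ext _ _ _ c (cdom c) cc
    (fun q => 2^-1 * (christoffel_mx h c m q m m + - christoffel_mx g c m q m m))).
    by move=> q _; rewrite /Y !christoffel_mxE mulrC.
  apply: (chart_smoothZ cc); apply: (chart_smoothD cc).
    exact: smooth_christoffel.
  by apply: (chart_smoothN cc); exact: smooth_christoffel.
pose D a b d := christoffel h c a b d q - christoffel g c a b d q.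
have Ds a b d : D a b d = D a d b.
  by rewrite /D -!christoffel_mxE (christoffel_sym h cq) (christoffel_sym g cq).
have Dp V : exists mu, forall a, \sum_b \sum_d D a b d * V b * V d = mu * V a.
  exact: reparametrise_christoffel gh cq.
have := proportional_quadratic Ds Dp i' k' j'; rewrite /Y -/(D j' j' j') -/(D k' k' k').
rewrite {1}/D; move: (D _ _ _) (D _ _ _) => x y; lra.
Qed.

End ProjectiveInvariance.

(** * Weyl nullity *)

Section WeylNullity.
Variables (R : realType) (n : nat) (M : manifold R n) (g : metric M).
Hypothesis n2 : (2 <= n)%N.
Variables (x : M).

Let n1 : (n.-1)%:R != 0 :> R.
Proof. by rewrite pnatr_eq0 -lt0n -ltnS prednK // (ltn_trans _ n2). Qed.

Let nE : n%:R = (n.-1)%:R + 1 :> R.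
Proof. by rewrite natr1 prednK // (ltn_trans _ n2). Qed.

Section InChart.
Variables (c : chart M) (w : 'cV[R]_n).
Hypothesis cx : cdom c x.

Definition flat l : R := \sum_j w j ord0 * g c x j l.

(** The eigenvalue equation with its index lowered. In this form it comes directly out of the
    contractions, and both of its sides change chart as covectors. *)
Definition schouten_flat B := forall l,
  \sum_j schouten g c j l x * w j ord0 = B * flat l.

Lemma metricC i j : g c x i j = g c x j i.
Proof. by rewrite -[in LHS](Defs.metric_sym g cx) mxE. Qed.

Lemma flatE l : flat l = (g c x *m w) l ord0.
Proof. by rewrite mxE; apply: eq_bigr => j _; rewrite mulrC metricC. Qed.

Lemma flat_neq0 : w != 0 -> exists l, flat l != 0.
Proof.
move=> w0; apply/existsP; apply: contraNT w0; rewrite negb_exists => /forallP f0.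
rewrite -[w]mul1mx -(mulVmx (metric_nondegenerate g cx)) -mulmxA.
rewrite (_ : g c x *m w = 0) ?mulmx0 //; apply/colP => l.
by rewrite -flatE mxE; apply/eqP; have := f0 l; rewrite negbK.
Qed.

Lemma schoutenC i j : schouten g c i j x = schouten g c j i x.
Proof. by rewrite /schouten (ricci_sym g cx). Qed.

Lemma sum_constcurv i k l :
  \sum_j w j ord0 * constcurv g c i j k l x =
  (i == l)%:R * flat k - (i == k)%:R * flat l.
Proof.
rewrite /flat !mulr_sumr -sumrB; apply: eq_bigr => j _.
by rewrite /constcurv; ring.
Qed.

Lemma sum_weyl i k l : \sum_j weyl g c i j k l x * w j ord0 =
  \sum_j riemann g c i j k l x * w j ord0
  + (i == l)%:R * (\sum_j schouten g c j k x * w j ord0)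
  - (i == k)%:R * (\sum_j schouten g c j l x * w j ord0).
Proof.
rewrite !mulr_sumr -big_split -sumrB /=; apply: eq_bigr => j _.
by rewrite /weyl; move: (riemann _ _ _ _ _ _ _) => r; ring.
Qed.

(** The sum is w^T (g R_{kl}) w, where the matrix g R_{kl} is antisymmetric. *)
Lemma flat_riemann k l :
  \sum_i flat i * (\sum_j riemann g c i j k l x * w j ord0) = 0.
Proof.
pose G := g c x *m curvature_mx g c k l x; pose S := w^T *m G *m w.
have GT : G^T = - G.
  by apply/eqP; rewrite -addr_eq0 addrC; apply/eqP; exact: curvature_antisym.
have S0 : S ord0 ord0 = 0.
  have : S^T = - S by rewrite /S 2!trmx_mul trmxK GT mulNmx mulmxN mulmxA.
  by move=> /matrixP/(_ ord0 ord0); rewrite !mxE; lra.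
rewrite -[RHS]S0 /S /G mulmxA -mulmxA mxE; apply: eq_bigr => i _; congr (_ * _).
  by rewrite mxE; apply: eq_bigr => j _; rewrite mxE.
by rewrite mxE; apply: eq_bigr => j _; rewrite (curvatureE g cx).
Qed.

Lemma nullity_schouten_flat : w != 0 ->
  (forall i k l, \sum_j weyl g c i j k l x * w j ord0 = 0) ->
  exists B, schouten_flat B.
Proof.
move=> w0 W0; have [a fa] := flat_neq0 w0.
pose P l := \sum_j schouten g c j l x * w j ord0.
have RW i k l : \sum_j riemann g c i j k l x * w j ord0 =
    (i == k)%:R * P l - (i == l)%:R * P k.
  have := W0 i k l; rewrite sum_weyl -/(P k) -/(P l).
  by move: (\sum_j _) (P l) (P k) => r pl pk; lra.
have sym k l : flat k * P l = flat l * P k.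
  have := flat_riemann k l.
  rewrite (eq_bigr (fun i => P l * (flat i * (i == k)%:R)
    - P k * (flat i * (i == l)%:R))) => [|i _]; last by rewrite RW; ring.
  rewrite sumrB -!mulr_sumr !sum_deltar => /eqP; rewrite subr_eq0 => /eqP.
  by rewrite mulrC [P k * _]mulrC.
(* In indefinite signature v may be null, so B is read off from a nonzero component of v_flat and
   not from a contraction with v. *)
exists (P a / flat a) => l; rewrite -/(P l).
by apply: (mulfI fa); rewrite sym; field.
Qed.

Lemma schouten_flat_eigen B : schouten_flat B -> forall i,
  \sum_j schouten_up g c i j x * w j ord0 = B * w i ord0.
Proof.
move=> PB i.
transitivity (\sum_k invmx (g c x) i k * (B * flat k)).
  under eq_bigr => j _ do rewrite mulr_suml.
  rewrite exchange_big /=; apply: eq_bigr => k _; rewrite -PB mulr_sumr.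
  by apply: eq_bigr => j _; rewrite schoutenC -mulrA.
under eq_bigr => k _ do rewrite mulrCA flatE.
rewrite -mulr_sumr; congr (_ * _).
have := mulKmx (metric_nondegenerate g cx) w => /matrixP/(_ i ord0).
by rewrite mxE.
Qed.

Lemma schouten_flat_curvature B : schouten_flat B ->
  (forall i k l, \sum_j weyl g c i j k l x * w j ord0 = 0) ->
  forall i k l, \sum_j riemann g c i j k l x * w j ord0 =
    - B * \sum_j w j ord0 * constcurv g c i j k l x.
Proof.
move=> PB W0 i k l; have := W0 i k l; rewrite sum_weyl sum_constcurv !PB.
by move: (\sum_j _) (flat k) (flat l) => r a b; lra.
Qed.

(** Contracting i with k turns the left side into Ric_{jl} v^j and the right side into - B (1 - n)
    v_l; dividing by n - 1 gives the Schouten tensor. *)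
Lemma curvature_schouten_flat B :
  (forall i k l, \sum_j riemann g c i j k l x * w j ord0 =
    - B * \sum_j w j ord0 * constcurv g c i j k l x) -> schouten_flat B.
Proof.
move=> RK l; apply: (mulfI n1).
transitivity (\sum_a \sum_j riemann g c a j a l x * w j ord0).
  rewrite exchange_big mulr_sumr /=; apply: eq_bigr => j _.
  by rewrite /schouten /ricci mulrA mulrA mulfV // mul1r mulr_suml.
under eq_bigr => a _ do rewrite RK sum_constcurv eqxx mul1r.
rewrite -mulr_sumr sumrB; under eq_bigr => a _ do rewrite mulrC.
rewrite sum_deltar sumr_const card_ord -[flat l *+ n]mulr_natl nE.
by move: (flat l) => f; ring.
Qed.

Lemma curvature_weyl B :
  (forall i k l, \sum_j riemann g c i j k l x * w j ord0 =
    - B * \sum_j w j ord0 * constcurv g c i j k l x) ->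
  forall i k l, \sum_j weyl g c i j k l x * w j ord0 = 0.
Proof.
move=> RK i k l; have PB := curvature_schouten_flat RK.
by rewrite sum_weyl RK sum_constcurv !PB; ring.
Qed.

End InChart.

Lemma schouten_flat_change c c' (v : tangent x) B : cdom c x -> cdom c' x ->
  schouten_flat c' (v c') B -> schouten_flat c (v c) B.
Proof.
move=> cx cx' PB l; set J := jac c c' x.
have vE : v c' = J *m v c by exact: tcomp_law.
have flat_change : flat c (v c) l = \sum_b J b l * flat c' (v c') b.
  rewrite (flatE _ cx) (metric_law g cx cx') -!mulmxA -vE mxE.
  by apply: eq_bigr => b _; rewrite mxE (flatE _ cx').
rewrite flat_change mulr_sumr.
transitivity (\sum_b J b l * \sum_a schouten g c' a b x * v c' a ord0); last first.
  by apply: eq_bigr => b _; rewrite PB mulrCA.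
transitivity (\sum_j \sum_a \sum_b
    J b l * (schouten g c' a b x * (J a j * v c j ord0))).
  apply: eq_bigr => j _; rewrite /schouten (@ricci_change _ _ _ g c c' x j l (conj cx cx')).
  rewrite mulr_sumr mulr_suml; apply: eq_bigr => a _.
  rewrite mulr_sumr mulr_suml; apply: eq_bigr => b _.
  by rewrite -/J; move: (ricci _ _ _ _ _) => r; ring.
under eq_bigr => j _ do rewrite exchange_big /=.
rewrite exchange_big /=; apply: eq_bigr => b _.
rewrite exchange_big mulr_sumr /=; apply: eq_bigr => a _.
have -> : v c' a ord0 = \sum_j J a j * v c j ord0 by rewrite vE mxE.
by rewrite !mulr_sumr.
Qed.

End WeylNullity.

Theorem theorem3p3 (R : realType) (n : nat) (hn : (2 <= n)%N)
    (M : manifold R n) (m : set (metric M))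
    (hm : metric_projective_structure m)
    (x : M) (v : tangent x) (hv : tangent_neq0 v) :
  (weyl_nullity m v ->
     forall g : metric M, m g ->
       exists B : R,
         unique (schouten_eigen g v) B /\ curvature_nullity g v B)
  /\
  ((exists (g : metric M) (B : R), m g /\ curvature_nullity g v B) ->
     weyl_nullity m v).
Proof.
split=> [W0 g mg|[g [B [mg RK]]] h mh c cx].
  have [c0 cx0 v0] := hv.
  have [B PB] := nullity_schouten_flat cx0 v0 (W0 g mg c0 cx0).
  (* B was extracted in the single chart c0, where v is known to be nonzero; the same number has to
     serve in every chart. *)
  have PBc c : cdom c x -> schouten_flat g x c (v c) B.
    by move=> cx; exact: schouten_flat_change cx cx0 PB.
  exists B; split; last first.
    by move=> c cx; exact: schouten_flat_curvature (PBc c cx) (W0 g mg c cx).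
  split; first by move=> c cx i; have := schouten_flat_eigen cx (PBc c cx) i.
  move=> B' EB'; have [i vi] : exists i, v c0 i ord0 != 0.
    apply/existsP; apply: contraNT v0; rewrite negb_exists => /forallP f0.
    by apply/eqP/colP => i; apply/eqP; have := f0 i; rewrite negbK mxE.
  by apply: (mulIf vi); rewrite -(EB' c0 cx0 i) -(schouten_flat_eigen cx0 PB).
(* Membership in m relates g and h only to the base metric g0, so the Weyl tensors of g and h are
   compared through that of g0. *)
have [g0 mE] := hm; move: mg mh; rewrite mE /= => g0g g0h i k l.
rewrite -[RHS](curvature_weyl hn (RK c cx) i k l); apply: eq_bigr => j _.
by rewrite (weyl_proj_equiv _ _ _ _ hn g0h cx) (weyl_proj_equiv _ _ _ _ hn g0g cx).
Qed.
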